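(* Let $H$ be an infinite-dimensional separable complex Hilbert space, let $A\in S_1(H)$ be a trace class operator and let $B\in L(H)$ be a bounded linear operator. Then for any $z\in\rho(A)\cap\sigma_p(B)$, $$|\det(I-z^{-1}A)|\leq\frac{\|A-B\|}{d(z,\sigma(A))}\,F_A\left(\frac{1}{d(z,\sigma(A))}\right).$$
   Context: $L(H)$ is the space of bounded linear operators on $H$ and $\|\cdot\|$ the operator norm. $\sigma(A)$ and $\rho(A)$ denote the spectrum and the resolvent set of $A$, and $\sigma_p(B)$ the set of eigenvalues of $B$. (Since $\dim H=\infty$ and $A$ is compact, $0\in\sigma(A)$, so $z\neq 0$.) For a compact operator $A$ on $H$, $(\lambda_n(A))_{n\in\mathbb{N}}$ is the sequence of eigenvalues counted with algebraic multiplicity and ordered by decreasing modulus, with $\lambda_n(A)=0$ for $n>N$ if there are only finitely many, $N$, non-zero eigenvalues; $s_n(A)=\sqrt{\lambda_n(A^*A)}$ is the $n$-th singular value. $S_1(H)$ is the set of compact $A\in L(H)$ with $\|A\|_1=\sum_{k=1}^\infty s_k(A)<\infty$. For $A\in S_1(H)$ the determinant is $\det(I-A)=\prod_{k=1}^\infty(1-\lambda_k(A))$, and $F_A:[0,\infty)\to[0,\infty)$ is defined by $F_A(r)=\prod_{k=1}^\infty(1+r\,s_k(A))$. For $z\in\mathbb{C}$ and compact $\sigma\subset\mathbb{C}$, $d(z,\sigma)=\inf_{\lambda\in\sigma}|z-\lambda|$. *)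

(* Defs.v *)
From HB Require Import structures.
From mathcomp Require Import all_boot all_order all_algebra.
From mathcomp Require Import complex.
From mathcomp Require Import all_classical all_reals all_analysis.

Set Implicit Arguments.
Unset Strict Implicit.
Unset Printing Implicit Defensive.

Import Order.TTheory GRing.Theory Num.Theory.
Import numFieldNormedType.Exports.
Local Open Scope classical_set_scope.
Local Open Scope complex_scope.
Local Open Scope ring_scope.

HB.mixin Record CompleteNormedModule_isHilbert (R : realType) H
    of CompleteNormedModule R[i] H := {
  inner : {dot H for @conjc R} ;
  inner_norm : forall x : H, `|x| ^+ 2 = inner x x
}.

#[short(type="hilbertType")]
HB.structure Definition Hilbert (R : realType) :=
  {H of CompleteNormedModule_isHilbert R H & CompleteNormedModule R[i] H}.

(* In a normed space over R[i] the norm takes its values in R[i], where it is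
   a nonnegative real; rnorm is the same norm with values in R. *)
Definition rnorm (R : realType) (V : normedZmodType R[i]) (x : V) : R :=
  complex.Re `|x|.

Section LinearAlgebra.
Variables (R : realType) (V : lmodType R[i]).
Implicit Types (E : set V).

Definition linear_span n (e : 'I_n -> V) : set V :=
  [set x | exists c : 'I_n -> R[i], x = \sum_(i < n) c i *: e i].

Definition linearly_independent n (e : 'I_n -> V) : Prop :=
  forall c : 'I_n -> R[i], \sum_(i < n) c i *: e i = 0 -> forall i, c i = 0.

Definition has_dim E (n : nat) : Prop :=
  exists e : 'I_n -> V, linearly_independent e /\ E = linear_span e.

Definition infinite_dimensional : Prop := ~ exists n, has_dim [set: V] n.

End LinearAlgebra.
Arguments infinite_dimensional {R} V.

Definition separable (T : topologicalType) : Prop :=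
  exists2 S : set T, countable S & dense S.

(* Operators are plain functions H -> H in the definitions below; linearity is
   carried by the type {linear H -> H} where it matters. *)
Section Operators.
Variables (R : realType) (H : hilbertType R).
Implicit Types (A T : H -> H) (z : R[i]) (r : R) (lam : nat -> R[i]).

Definition bounded_operator A : Prop :=
  exists M : R, forall x, rnorm (A x) <= M * rnorm x.

Definition opnorm A : R := sup [set rnorm (A x) | x in [set x | rnorm x <= 1]].

Definition compact_operator A : Prop :=
  precompact (A @` [set x | rnorm x <= 1]).

Definition resolvent_set A : set R[i] :=
  [set z | exists2 S : {linear H -> H}, bounded_operator S &
     (forall x, S (z *: x - A x) = x) /\ (forall x, z *: S x - A (S x) = x)].

Definition spectrum A : set R[i] := ~` resolvent_set A.

Definition point_spectrum A : set R[i] :=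
  [set z | exists2 x : H, x != 0 & A x = z *: x].

Definition adjoint A : H -> H :=
  fun y => xget 0 [set w | forall x, inner (A x) y = inner x w].

Definition generalized_eigenspace A z : set H :=
  [set x | exists k, iter k (fun y => A y - z *: y) x = 0].

Definition algebraic_multiplicity A z (n : nat) : Prop :=
  has_dim (generalized_eigenspace A z) n.

(* lam enumerates the eigenvalues of the compact operator A by decreasing
   modulus, each non-zero z occurring as often as its algebraic multiplicity
   (0 if z is not an eigenvalue). Monotonicity forces lam to end with zeros
   when there are finitely many non-zero eigenvalues and to contain no zero
   otherwise. Only the order among eigenvalues of equal modulus is left free. *)
Definition eigenvalue_enumeration A lam : Prop :=
  (forall n, rnorm (lam n.+1) <= rnorm (lam n)) /\
  (forall z, z != 0 -> exists2 m, algebraic_multiplicity A z m &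
     ([set k | lam k = z] #= `I_m)%card).

(* Sequences are indexed from 0: eigenvalue A k is the (k+1)-st eigenvalue. *)
Definition eigenvalue A : nat -> R[i] :=
  xget (fun=> 0) [set lam | eigenvalue_enumeration A lam].

(* The eigenvalues of A^* A are nonnegative reals. *)
Definition singular_value A (k : nat) : R :=
  Num.sqrt (complex.Re (eigenvalue (adjoint A \o A) k)).

Definition trace_norm A : \bar R := (\sum_(0 <= k <oo) (singular_value A k)%:E)%E.

Definition trace_class A : Prop :=
  compact_operator A /\ (trace_norm A < +oo)%E.

(* det (I - T) *)
Definition det_1sub T : R[i]^o :=
  lim ((fun n => \prod_(k < n) (1 - eigenvalue T k) : R[i]^o) @ \oo).

Definition detF A r : R :=
  lim ((fun n => \prod_(k < n) (1 + r * singular_value A k)) @ \oo).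

End Operators.

Definition dist_to (R : realType) (z : R[i]) (S : set R[i]) : R :=
  inf [set rnorm (z - l) | l in S].

(* Main.v *)
(* Put T = A / z and d = d(z, sigma(A)). Since 0 lies in sigma(A), d <= |z|, and an
   eigenvector x of B for z satisfies x - T x = (B x - A x) / z; so it suffices to show
     |det (I - T)| |x| <= |x - T x| \prod_k (1 + s_k(T)).
   For a matrix this follows from Hadamard's inequality in an orthonormal basis whose
   last vector is x / |x| and whose k-th vector is orthogonal to the first k right
   singular vectors, so that the k-th factor is at most 1 + s_k.
   In general, triangularize T on an n-dimensional invariant subspace W carrying the
   eigenvalues lambda_0, ..., lambda_(n-1), and enlarge W to a finite-dimensional space
   E that contains x and on which the compression of T is close to T. The determinant
   of the compression of I - T to E is \prod_(k < n) (1 - lambda_k) times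
   p(1), where p(a) = \prod_i (1 - a mu_i) and the mu_i are the eigenvalues of a
   compression to the orthogonal complement of W; they are as small as lambda_n.
   Finally p(1) is close to 1, which replaces Lidskii's theorem: as |p(a)| is at most
   \prod_k (1 + |a| s_k) = exp(o(|a|)), the sum of the mu_i has to be small. *)
Require Import Defs.
From HB Require Import structures.
From mathcomp Require Import all_boot all_order all_algebra.
From mathcomp Require Import complex ring lra.
From mathcomp Require Import all_classical all_reals all_analysis.
Import Order.TTheory GRing.Theory Num.Theory.
Import numFieldNormedType.Exports.
Local Open Scope classical_set_scope.
Local Open Scope complex_scope.
Local Open Scope ring_scope.
Set Implicit Arguments.
Unset Strict Implicit.
Unset Printing Implicit Defensive.

(** * Norms and inner products *)

Local Notation "''[' u , v ]" := (inner u v) : ring_scope.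

(** Of the singular values of A the estimates use three facts: they are nonnegative, they are
    summable, and |A x| <= s_k |x| on the orthogonal complement of some k vectors. This Gelfand form
    survives scaling and compression and restricts directly to matrices. Eigenvalues are reached
    through flags, orthonormal families in which T is triangular. A flag grows by an eigenvector of
    the compression of T to its orthogonal complement, and its diagonal counts algebraic
    multiplicities. The obstacle is that the dimension of E, hence the number of mu_i, is not
    controlled, so every bound on p must be uniform in dim E. That each mu_i is small comes from
    compactness: the compression Q of T to the complement of W has no eigenvalue of modulus above
    rho, so |y - a Q y| >= gap |y| for all |a| <= 1/rho with one gap > 0, and a section whose error
    is at most rho * gap inherits the bound rho on its eigenvalues. *)

Section RealNorm.
Variable R : realType.
Implicit Types (V : normedZmodType R[i]) (a b : R[i]).

Lemma normE V (x : V) : `|x| = (rnorm x)%:C.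
Proof.
have := normr_ge0 x; rewrite /rnorm.
by case: `|x| => a b; rewrite lecE /= => /andP[/eqP-> _].
Qed.

Lemma rnorm_ge0 V (x : V) : 0 <= rnorm x.
Proof. by have := normr_ge0 x; rewrite normE ler0c. Qed.

Lemma rnorm0 V : rnorm (0 : V) = 0.
Proof. by rewrite /rnorm normr0. Qed.

Lemma rnorm_eq0 V (x : V) : (rnorm x == 0) = (x == 0).
Proof.
by rewrite -(normr_eq0 x) normE (inj_eq (@complexI R)).
Qed.

Lemma rnorm_gt0 V (x : V) : (0 < rnorm x) = (x != 0).
Proof. by rewrite lt_def rnorm_ge0 andbT rnorm_eq0. Qed.

Lemma rnormN V (x : V) : rnorm (- x) = rnorm x.
Proof. by rewrite /rnorm normrN. Qed.

Lemma rnormB V (x y : V) : rnorm (x - y) = rnorm (y - x).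
Proof. by rewrite -rnormN opprB. Qed.

Lemma rnormD V (x y : V) : rnorm (x + y) <= rnorm x + rnorm y.
Proof. by have := ler_normD x y; rewrite !normE -rmorphD lecR. Qed.

Lemma rnorm_triB V (x y : V) : rnorm (x - y) <= rnorm x + rnorm y.
Proof. by rewrite -(rnormN y); apply: rnormD. Qed.

Lemma rnorm_tri V (z x y : V) : rnorm (x - y) <= rnorm (x - z) + rnorm (z - y).
Proof. by rewrite -[x - y](subrKA z); apply: rnormD. Qed.

Lemma rnorm_sub V (x y : V) : rnorm x <= rnorm (x - y) + rnorm y.
Proof. by rewrite -{1}[x](subrK y); apply: rnormD. Qed.

Lemma rnormZ (V : normedModType R[i]) a (x : V) :
  rnorm (a *: x) = rnorm a * rnorm x.
Proof. by apply: (@complexI R); rewrite rmorphM/= -!normE normrZ. Qed.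

Lemma rnormM a b : rnorm (a * b) = rnorm a * rnorm b.
Proof. by apply: (@complexI R); rewrite rmorphM/= -!normE normrM. Qed.

Lemma rnormV a : rnorm a^-1 = (rnorm a)^-1.
Proof. by apply: (@complexI R); rewrite fmorphV/= -!normE normfV. Qed.

Lemma rnorm1 : rnorm (1 : R[i]) = 1.
Proof. by rewrite /rnorm normr1. Qed.

Lemma rnorm_prod I (r : seq I) (P : pred I) (F : I -> R[i]) :
  rnorm (\prod_(i <- r | P i) F i) = \prod_(i <- r | P i) rnorm (F i).
Proof.
by elim/big_rec2: _ => [|i x y _ <-]; rewrite ?rnorm1 ?rnormM.
Qed.

Lemma rnorm_real (r : R) : rnorm (r%:C) = `|r|.
Proof.
rewrite /rnorm -[`|r%:C|]/((Num.sqrt (r ^+ 2 + 0 ^+ 2))%:C) /=.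
by rewrite expr0n addr0 sqrtr_sqr.
Qed.

Lemma rnorm_conj a : rnorm (a^*)%C = rnorm a.
Proof. by rewrite /rnorm (norm_conjC a). Qed.

Lemma rnormE2 a : rnorm a ^+ 2 = complex.Re a ^+ 2 + complex.Im a ^+ 2.
Proof.
case: a => a b; rewrite /rnorm -[`|_|]/((Num.sqrt (a ^+ 2 + b ^+ 2))%:C) /=.
by rewrite sqr_sqrtr // addr_ge0 ?sqr_ge0.
Qed.

Lemma mulC_conj a : a * (a^*)%C = (rnorm a ^+ 2)%:C.
Proof. by rewrite rmorphXn/= -normE normCK. Qed.

Lemma Re_le_rnorm a : `|complex.Re a| <= rnorm a.
Proof.
rewrite -(@ler_pXn2r _ 2) ?nnegrE ?rnorm_ge0 // real_normK ?num_real //.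
by rewrite rnormE2 lerDl sqr_ge0.
Qed.

Lemma conjM a b : ((a * b)^*)%C = (a^*)%C * (b^*)%C.
Proof. exact: rmorphM. Qed.

Lemma CrM (r t : R) : (r * t)%:C = r%:C * t%:C.
Proof. exact: rmorphM. Qed.

Lemma CrN (r : R) : (- r)%:C = - r%:C.
Proof. exact: rmorphN. Qed.

Lemma ReD a b : complex.Re (a + b) = complex.Re a + complex.Re b.
Proof. by case: a b => [? ?] [? ?]. Qed.

Lemma ReN a : complex.Re (- a) = - complex.Re a.
Proof. by case: a. Qed.

Lemma Re_conj a : complex.Re (a^*)%C = complex.Re a.
Proof. by case: a. Qed.

Lemma Re_realM (r : R) a : complex.Re (r%:C * a) = r * complex.Re a.
Proof. by case: a => x y /=; rewrite mul0r subr0. Qed.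

End RealNorm.

Section Inner.
Variables (R : realType) (H : hilbertType R).
Implicit Types (x y z : H) (a b : R[i]).

Implicit Type T : {linear H -> H}.
Lemma op0 T : T 0 = 0. Proof. exact: linear0. Qed.
Lemma opD T x y : T (x + y) = T x + T y. Proof. exact: linearD. Qed.
Lemma opB T x y : T (x - y) = T x - T y. Proof. exact: linearB. Qed.
Lemma opZ T a x : T (a *: x) = a *: T x. Proof. exact: linearZ. Qed.
Lemma op_sum T I (r : seq I) (P : pred I) (F : I -> H) :
  T (\sum_(i <- r | P i) F i) = \sum_(i <- r | P i) T (F i).
Proof. exact: linear_sum. Qed.

Lemma ipC x y : '[x, y] = ('[y, x]^*)%C.
Proof. by rewrite hermC expr0 mul1r. Qed.

Lemma ipDl x y z : '[x + y, z] = '[x, z] + '[y, z].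
Proof. exact: linearDl. Qed.
Lemma ipDr x y z : '[z, x + y] = '[z, x] + '[z, y].
Proof. exact: linearDr. Qed.
Lemma ipNl x z : '[- x, z] = - '[x, z].
Proof. exact: linearNl. Qed.
Lemma ipNr x z : '[z, - x] = - '[z, x].
Proof. exact: linearNr. Qed.
Lemma ipBl x y z : '[x - y, z] = '[x, z] - '[y, z].
Proof. by rewrite ipDl ipNl. Qed.
Lemma ipBr x y z : '[z, x - y] = '[z, x] - '[z, y].
Proof. by rewrite ipDr ipNr. Qed.
Lemma ipZl a x z : '[a *: x, z] = a * '[x, z].
Proof. exact: linearZl_LR. Qed.
Lemma ipZr a x z : '[z, a *: x] = (a^*)%C * '[z, x].
Proof. exact: linearZr_LR. Qed.
Lemma ip0l z : '[0, z] = 0.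
Proof. exact: linear0l. Qed.
Lemma ip0r z : '[z, 0] = 0.
Proof. exact: linear0r. Qed.
Lemma ip_suml I (r : seq I) (P : pred I) (F : I -> H) z :
  '[\sum_(i <- r | P i) F i, z] = \sum_(i <- r | P i) '[F i, z].
Proof. by rewrite (big_morph (fun x => '[x, z]) (fun x y => ipDl x y z) (ip0l z)). Qed.
Lemma ip_sumr I (r : seq I) (P : pred I) (F : I -> H) z :
  '[z, \sum_(i <- r | P i) F i] = \sum_(i <- r | P i) '[z, F i].
Proof. by rewrite (big_morph (fun x => '[z, x]) (fun x y => ipDr x y z) (ip0r z)). Qed.

Lemma ipxx x : '[x, x] = (rnorm x ^+ 2)%:C.
Proof. by rewrite -inner_norm rmorphXn/= -normE. Qed.

Lemma ip0_sym x y : '[x, y] = 0 -> '[y, x] = 0.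
Proof. by move=> xy; rewrite ipC xy conjc0. Qed.

Lemma rnormD2 x y :
  rnorm (x + y) ^+ 2 = rnorm x ^+ 2 + rnorm y ^+ 2 + 2 * complex.Re '[x, y].
Proof.
have := ipxx (x + y).
rewrite ipDl !ipDr !ipxx [X in _ + (X + _)]ipC => /(congr1 (@complex.Re R)).
rewrite !ReD Re_conj /= => <-.
by rewrite mulr_natl mulr2n; ring.
Qed.

Lemma pythagoras x y : '[x, y] = 0 ->
  rnorm (x + y) ^+ 2 = rnorm x ^+ 2 + rnorm y ^+ 2.
Proof. by move=> xy; rewrite rnormD2 xy mulr0 addr0. Qed.

Lemma parallelogram x y :
  rnorm (x - y) ^+ 2 = 2 * rnorm x ^+ 2 + 2 * rnorm y ^+ 2 - rnorm (x + y) ^+ 2.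
Proof. by rewrite !rnormD2 ipNr rnormN ReN; ring. Qed.

Lemma ip_ext x y : (forall z, '[x, z] = '[y, z]) -> x = y.
Proof.
move=> e; apply/eqP; rewrite -subr_eq0 -rnorm_eq0 -sqrf_eq0.
by rewrite -(inj_eq (@complexI R)) -ipxx ipBl e subrr.
Qed.

Lemma cauchy_schwarz x y : rnorm '[x, y] <= rnorm x * rnorm y.
Proof.
have [->|y0] := eqVneq y 0; first by rewrite ip0r !rnorm0 mulr0.
have ny0 : 0 < rnorm y by rewrite rnorm_gt0.
have ny2 : rnorm y ^+ 2 != 0 by rewrite sqrf_eq0 gt_eqF.
pose c := '[x, y] * ((rnorm y ^+ 2)^-1)%:C.
have ort : '[c *: y, x - c *: y] = 0.
  rewrite ipZl ipBr ipZr (ipC y x) /c !conjM conjc_real ipxx -mulrA -CrM.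
  by rewrite mulVf // mulr1 subrr mulr0.
have : rnorm (c *: y) ^+ 2 <= rnorm x ^+ 2.
  by rewrite -{1}[x](subrKC (c *: y)) (pythagoras ort) lerDl sqr_ge0.
rewrite ler_pXn2r ?nnegrE ?rnorm_ge0 // rnormZ rnormM rnorm_real.
rewrite ger0_norm ?invr_ge0 ?sqr_ge0 // expr2 invfM -!mulrA mulVf ?gt_eqF //.
by rewrite mulr1 ler_pdivrMr.
Qed.

End Inner.

(** * Orthonormal families *)

(** Finite families are sequences of which only an initial segment matters, so appending at index
    [n] may overwrite everything after it. *)
Definition set_at (X : Type) (e : nat -> X) n x : nat -> X :=
  fun k => if (k < n)%N then e k else x.

Lemma set_atE (X : Type) (e : nat -> X) n x i : (i < n)%N -> set_at e n x i = e i.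
Proof. by rewrite /set_at => ->. Qed.

Lemma set_atx (X : Type) (e : nat -> X) n x : set_at e n x n = x.
Proof. by rewrite /set_at ltnn. Qed.

Section Orthonormal.
Variables (R : realType) (H : hilbertType R).
Implicit Types (x y z : H) (a b : R[i]) (e f : nat -> H) (n : nat).

Definition orthonormal_upto e n : Prop :=
  forall i j, (i < n)%N -> (j < n)%N -> '[e i, e j] = (i == j)%:R.

(** Membership of [x] in the span of the first [n] vectors is written [oproj e n x = x] throughout,
    and orthogonality to them [oproj e n x = 0]. *)
Definition oproj e n x : H := \sum_(i < n) '[x, e i] *: e i.

Lemma oproj0 e x : oproj e 0 x = 0.
Proof. by rewrite /oproj big_ord0. Qed.

Lemma oprojS e n x : oproj e n.+1 x = oproj e n x + '[x, e n] *: e n.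
Proof. by rewrite /oproj big_ord_recr. Qed.

Lemma oproj_is_linear e n : linear (oproj e n).
Proof.
move=> a x y; rewrite /oproj scaler_sumr -big_split /=.
by apply: eq_bigr => i _; rewrite ipDl ipZl scalerDl scalerA.
Qed.
HB.instance Definition _ e n := GRing.isLinear.Build R[i] H H *:%R (oproj e n)
  (oproj_is_linear e n).

Lemma eq_oproj e f n x : (forall i, (i < n)%N -> e i = f i) ->
  oproj e n x = oproj f n x.
Proof. by move=> ef; apply: eq_bigr => i _; rewrite ef. Qed.

Lemma orthonormal_uptoW e n m : (m <= n)%N ->
  orthonormal_upto e n -> orthonormal_upto e m.
Proof. by move=> mn o i j im jm; apply: o; apply: leq_trans mn. Qed.

Lemma eq_orthonormal e f n : (forall i, (i < n)%N -> e i = f i) ->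
  orthonormal_upto e n -> orthonormal_upto f n.
Proof. by move=> ef o i j im jm; rewrite -!ef // o. Qed.

Lemma rnorm_unit e n i : orthonormal_upto e n -> (i < n)%N -> rnorm (e i) = 1.
Proof.
move=> o ilt; apply/eqP; rewrite -(@eqrXn2 _ 2) ?rnorm_ge0 ?ler01 // expr1n.
by rewrite -(inj_eq (@complexI R)) -ipxx o // eqxx.
Qed.

Lemma rnorm_unit_ip x : rnorm x = 1 -> '[x, x] = 1.
Proof. by rewrite ipxx => ->; rewrite expr1n. Qed.

Lemma ip_oproj e n x y : '[oproj e n x, y] = '[x, oproj e n y].
Proof.
rewrite ip_suml ip_sumr; apply: eq_bigr => i _.
by rewrite ipZl ipZr mulrC -ipC.
Qed.

Lemma ip_oproj_e e n x i : orthonormal_upto e n -> (i < n)%N ->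
  '[oproj e n x, e i] = '[x, e i].
Proof.
move=> o ilt; rewrite ip_suml (bigD1 (Ordinal ilt)) //= big1 => [|j ji].
  by rewrite ipZl o // eqxx mulr1 addr0.
rewrite ipZl o // (_ : _ == _ = false) ?mulr0 //.
by apply/negbTE; rewrite -val_eqE /= in ji.
Qed.

Lemma oproj_id e n m x : orthonormal_upto e n -> (m <= n)%N ->
  oproj e m (oproj e n x) = oproj e m x.
Proof.
move=> o mn; apply: eq_bigr => i _.
by rewrite ip_oproj_e // (leq_trans _ mn).
Qed.

Lemma oproj_e e n i : orthonormal_upto e n -> (i < n)%N -> oproj e n (e i) = e i.
Proof.
move=> o ilt; rewrite /oproj (bigD1 (Ordinal ilt)) //= big1 => [|j ji].
  by rewrite o // eqxx scale1r addr0.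
rewrite o // (_ : _ == _ = false) ?scale0r //.
by apply/negbTE; rewrite eq_sym -val_eqE /= in ji *.
Qed.

Lemma oproj_span e n m x : orthonormal_upto e n -> (m <= n)%N ->
  oproj e m x = x -> oproj e n x = x.
Proof.
move=> o mn <-; rewrite {2}/oproj linear_sum; apply: eq_bigr => i _.
by rewrite linearZ /= oproj_e // (leq_trans _ mn).
Qed.

Lemma oproj_eq0 e n x : orthonormal_upto e n ->
  oproj e n x = 0 <-> (forall i, (i < n)%N -> '[x, e i] = 0).
Proof.
move=> o; split=> [p0 i ilt|x0].
  by rewrite -(ip_oproj_e x o ilt) p0 ip0l.
by rewrite /oproj big1 // => i _; rewrite x0 // scale0r.
Qed.

Lemma oproj_compl e n x : orthonormal_upto e n -> oproj e n (x - oproj e n x) = 0.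
Proof. by move=> o; rewrite linearB /= oproj_id // subrr. Qed.

Lemma ip_oproj_compl e n x y : orthonormal_upto e n ->
  '[oproj e n x, y - oproj e n y] = 0.
Proof. by move=> o; rewrite ip_oproj oproj_compl // ip0r. Qed.

Lemma oproj_pythagoras e n x : orthonormal_upto e n ->
  rnorm x ^+ 2 = rnorm (oproj e n x) ^+ 2 + rnorm (x - oproj e n x) ^+ 2.
Proof.
by move=> o; rewrite -(pythagoras (ip_oproj_compl x x o)) subrKC.
Qed.

Lemma rnorm_oproj e n x : orthonormal_upto e n -> rnorm (oproj e n x) <= rnorm x.
Proof.
move=> o; rewrite -(@ler_pXn2r _ 2) ?nnegrE ?rnorm_ge0 //.
by rewrite (oproj_pythagoras x o) lerDl sqr_ge0.
Qed.

Lemma rnorm_oproj_compl e n x : orthonormal_upto e n ->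
  rnorm (x - oproj e n x) <= rnorm x.
Proof.
move=> o; rewrite -(@ler_pXn2r _ 2) ?nnegrE ?rnorm_ge0 //.
by rewrite (oproj_pythagoras x o) lerDr sqr_ge0.
Qed.

Lemma oproj_fix_of_ortho e n x : orthonormal_upto e n ->
  (forall y, oproj e n y = 0 -> '[x, y] = 0) -> oproj e n x = x.
Proof.
move=> o h; apply/eqP; rewrite eq_sym -subr_eq0 -rnorm_eq0 -sqrf_eq0.
rewrite -(inj_eq (@complexI R)) -ipxx ipBl h ?oproj_compl //.
by rewrite ip_oproj_compl // subrr.
Qed.

Lemma rnorm_comb2 f n (v : 'I_n -> R[i]) : orthonormal_upto f n ->
  rnorm (\sum_(i < n) v i *: f i) ^+ 2 = \sum_(i < n) rnorm (v i) ^+ 2.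
Proof.
elim: n v => [|n IH] v o; first by rewrite !big_ord0 rnorm0 expr0n.
rewrite !big_ord_recr /= pythagoras ?IH; last 2 first.
- exact: orthonormal_uptoW o.
- rewrite ip_suml big1 // => i _; rewrite ipZl ipZr o // ?ltn_eqF ?mulr0 //.
  exact: ltn_trans (ltn_ord i) _.
by rewrite rnormZ (rnorm_unit o) ?mulr1.
Qed.

Lemma ip_comb f n (v : 'I_n -> R[i]) j : orthonormal_upto f n ->
  '[\sum_(i < n) v i *: f i, f (j : 'I_n)] = v j.
Proof.
move=> o; rewrite ip_suml (bigD1 j) //= ipZl o // eqxx mulr1 big1 ?addr0 //.
move=> i ij; rewrite ipZl o // (_ : _ == _ = false) ?mulr0 //.
by apply/negbTE; rewrite -val_eqE in ij.
Qed.

Lemma orthonormal_set_at e n x : orthonormal_upto e n -> rnorm x = 1 ->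
  oproj e n x = 0 -> orthonormal_upto (set_at e n x) n.+1.
Proof.
move=> o x1 /(oproj_eq0 _ o) xo i j; rewrite /set_at !ltnS.
rewrite leq_eqVlt => /predU1P[->|il]; rewrite leq_eqVlt => /predU1P[->|jl].
- by rewrite ltnn eqxx rnorm_unit_ip.
- by rewrite ltnn jl xo // gtn_eqF.
- by rewrite ltnn il ip0_sym ?xo // ltn_eqF.
- by rewrite il jl o.
Qed.

Definition normalize x : H := ((rnorm x)^-1)%:C *: x.

Lemma rnorm_normalize x : x != 0 -> rnorm (normalize x) = 1.
Proof.
move=> x0; rewrite rnormZ rnorm_real ger0_norm ?invr_ge0 ?rnorm_ge0 //.
by rewrite mulVf // rnorm_eq0.
Qed.

Lemma normalizeK x : x = (rnorm x)%:C *: normalize x.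
Proof.
have [->|x0] := eqVneq x 0; first by rewrite rnorm0 scale0r.
by rewrite scalerA -CrM mulfV ?scale1r // rnorm_eq0.
Qed.

Lemma gram_schmidt e n (s : seq H) : orthonormal_upto e n ->
  exists f m, [/\ (n <= m)%N, orthonormal_upto f m,
    (forall i, (i < n)%N -> f i = e i) & forall y, y \in s -> oproj f m y = y].
Proof.
elim: s e n => [|y s IH] e n o; first by exists e, n; split.
have [yW|yW] := eqVneq (oproj e n y) y.
  have [f [m [nm fo fe fs]]] := IH e n o; exists f, m; split=> // z.
  rewrite inE => /predU1P[->|]; last exact: fs.
  by apply: (oproj_span fo nm); rewrite -(eq_oproj _ (fun i h => esym (fe i h))).
pose v := normalize (y - oproj e n y).
have v0 : y - oproj e n y != 0 by rewrite subr_eq0 eq_sym.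
have oe : orthonormal_upto (set_at e n v) n.+1.
  apply: orthonormal_set_at => //; first exact: rnorm_normalize.
  by rewrite /v /normalize linearZ /= oproj_compl // scaler0.
have [f [m [nm fo fe fs]]] := IH _ _ oe.
have fei i : (i < n)%N -> f i = e i.
  by move=> ilt; rewrite fe ?set_atE // ltnS ltnW.
exists f, m; split=> //; first exact: ltnW.
move=> z; rewrite inE => /predU1P[->|]; last exact: fs.
apply: (oproj_span fo nm); rewrite -(eq_oproj _ (fun i h => esym (fe i h))).
have yE : y = (rnorm (y - oproj e n y))%:C *: v + oproj e n y.
  by rewrite -normalizeK subrK.
have pv : oproj (set_at e n v) n.+1 v = v.
  by rewrite -{2 3}(set_atx e n v) oproj_e.
have pw : oproj (set_at e n v) n.+1 (oproj e n y) = oproj e n y.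
  by apply: (oproj_span oe (leqnSn n)); rewrite (eq_oproj _ (set_atE e v)) oproj_id.
by rewrite yE linearP /= pv pw.
Qed.

End Orthonormal.

(** * Compact operators *)

Lemma small_inv (R : realType) (c : R) : 0 < c ->
  exists N, forall n, (N <= n)%N -> n.+1%:R^-1 < c.
Proof.
move=> c0; exists (Num.truncn c^-1) => n Nn.
rewrite -[X in _ < X]invrK ltf_pV2 ?posrE ?invr_gt0 ?ltr0n //.
by apply: lt_le_trans (truncnS_gt _) _; rewrite ler_nat ltnS.
Qed.

Section Sequences.
Variables (R : realType) (H : hilbertType R).
Implicit Types (x y z : H) (a b : R[i]) (u : nat -> H).

Definition tends u (l : H) : Prop :=
  forall eps : R, 0 < eps ->
  exists N, forall n, (N <= n)%N -> rnorm (u n - l) < eps.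

Lemma Re_gt0 (eps : R[i]) : 0 < eps -> eps = (complex.Re eps)%:C /\ 0 < complex.Re eps.
Proof. by case: eps => a b; rewrite ltcE /= => /andP[/eqP-> ->]. Qed.

Lemma hilbert_complete u :
  (forall eps : R, 0 < eps -> exists N, forall n, (N <= n)%N -> rnorm (u n - u N) < eps) ->
  exists l, tends u l.
Proof.
move=> cu.
have cF : cauchy (u @ \oo).
  apply: cauchy_exP => eps /Re_gt0[-> e0].
  have [N hN] := cu _ e0; exists (u N); exists N => // n /= Nn.
  by rewrite -ball_normE /= normE ltcR rnormB hN.
have ul : cvg (u @ \oo) by exact: cauchy_cvg cF.
exists (lim (u @ \oo)) => eps e0.
move/cvgrPdist_lt : ul => /(_ (eps%:C)); rewrite ltcR => /(_ e0)[N _ hN].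
by exists N => n Nn; have := hN n Nn; rewrite /= normE ltcR rnormB.
Qed.

(** Sequential compactness with a cluster point in place of a convergent subsequence, which avoids
    extracting and reindexing. *)
Definition cluster_compact (T : H -> H) : Prop :=
  forall u, (forall n, rnorm (u n) <= 1) ->
  exists y, forall (eps : R) N, 0 < eps ->
  exists2 n, (N <= n)%N & rnorm (T (u n) - y) < eps.

Lemma compact_operator_cluster (T : H -> H) :
  compact_operator T -> cluster_compact T.
Proof.
move=> [U /= TU [cU _]] u u1.
have FU : ((T \o u) @ \oo) U.
  by exists 0%N => // n _ /=; apply: TU; exists (u n) => //=; exact: u1.
have [y [_ cy]] := cU _ _ FU.
exists y => eps N e0.
have FA : ((T \o u) @ \oo) [set T (u n) | n in [set n | (N <= n)%N]].
  by exists N => // n Nn /=; exists n.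
have yB : nbhs y (ball y (eps%:C)) by apply: nbhsx_ballx; rewrite ltcR.
have [_ [[n Nn <-]]] := cy _ _ FA yB.
by rewrite -ball_normE /= normE ltcR rnormB; exists n.
Qed.

(** An unbounded [T] would map some [u n] of the unit ball to norm above [n], and such images have
    no cluster point. *)
Lemma cluster_compact_bounded (T : {linear H -> H}) : cluster_compact T ->
  exists2 M : R, 0 < M & forall x, rnorm (T x) <= M * rnorm x.
Proof.
move=> cT.
have [[M [M0 hM]]|] := pselect (exists M : R, 0 < M /\ forall x, rnorm x <= 1 -> rnorm (T x) <= M).
  exists M => // x; rewrite {1}[x]normalizeK linearZ rnormZ rnorm_real.
  rewrite ger0_norm ?rnorm_ge0 // mulrC ler_wpM2r ?rnorm_ge0 //.
  have [->|x0] := eqVneq x 0; last by rewrite hM ?rnorm_normalize.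
  by rewrite /normalize scaler0 linear0 rnorm0 ltW.
move=> /forallNP nM.
have hx n : exists x, rnorm x <= 1 /\ n%:R < rnorm (T x).
  have /not_andP[/negP|/existsNP[x /not_implyP[x1 /negP]]] := nM n.+1%:R.
    by rewrite ltr0n.
  rewrite -ltNge => h; exists x; split=> //.
  by apply: le_lt_trans h; rewrite ler_nat.
have [u hu] := choice hx.
have [y hy] := cT u (fun n => (hu n).1).
pose N := (Num.truncn (rnorm y + 1)).+1.
have [n Nn h] := hy 1 N ltr01.
have := rnorm_sub (T (u n)) y; rewrite leNgt => /negP[].
apply: lt_le_trans (_ : rnorm y + 1 <= _); first by rewrite addrC ltrD2l.
apply: le_trans (ltW (hu n).2); apply/ltW/(lt_le_trans (truncnS_gt _)).
by rewrite ler_nat.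
Qed.

Lemma cluster_compact_comp_l (T : H -> H) (B : {linear H -> H}) (M : R) :
  (forall x, rnorm (B x) <= M * rnorm x) -> cluster_compact T ->
  cluster_compact (B \o T).
Proof.
move=> hB cT u u1; have [y hy] := cT u u1; exists (B y) => eps N e0.
have M1 : 0 < `|M| + 1 by rewrite ltr_wpDl.
have [n Nn h] := hy (eps / (`|M| + 1)) N (divr_gt0 e0 M1).
exists n => //=; rewrite -linearB; apply: le_lt_trans (hB _) _.
rewrite ltr_pdivlMr // mulrC in h; apply: le_lt_trans h.
rewrite ler_wpM2r ?rnorm_ge0 //; apply: le_trans (ler_norm _) _.
by rewrite lerDl.
Qed.

Lemma cluster_compact_comp_r (T K : H -> H) :
  (forall x, rnorm (K x) <= rnorm x) -> cluster_compact T ->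
  cluster_compact (T \o K).
Proof.
move=> hK cT u u1; apply: (cT (K \o u)) => n.
exact: le_trans (hK _) (u1 n).
Qed.

Lemma rnorm_lim_le (T : {linear H -> H}) (M : R) (y : H) u l :
  (forall x, rnorm (T x) <= M * rnorm x) -> tends u l ->
  (forall eps : R, 0 < eps ->
    exists N, forall n, (N <= n)%N -> rnorm (T (u n) - y) < eps) -> T l = y.
Proof.
move=> hM ul Tu; apply/eqP; rewrite -subr_eq0 -rnorm_eq0 eq_le rnorm_ge0 andbT.
apply/ler_addgt0Pr => eps e0; rewrite add0r.
have M1 : 0 < `|M| + 1 by rewrite ltr_wpDl.
have e2 : 0 < eps / 2 by rewrite divr_gt0.
have [N1 h1] := ul _ (divr_gt0 e2 M1).
have [N2 h2] := Tu _ e2.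
pose n := maxn N1 N2.
have /h1 a1 : (N1 <= n)%N by rewrite leq_maxl.
have /h2 a2 : (N2 <= n)%N by rewrite leq_maxr.
apply: le_trans (rnorm_tri (T (u n)) _ _) _; rewrite (splitr eps) lerD //; last exact: ltW.
rewrite -linearB; apply: le_trans (hM _) _; rewrite rnormB.
move: a1; rewrite ltr_pdivlMr // mulrC => /ltW; apply: le_trans.
rewrite ler_wpM2r ?rnorm_ge0 //; apply: le_trans (ler_norm _) _.
by rewrite lerDl.
Qed.

(** A compact operator attains its norm. Weak compactness of the ball is avoided: along a maximizing
    sequence whose images converge to [y], midpoints are almost maximizing too, so their norms tend
    to 1 and uniform convexity makes the sequence itself converge. *)
Lemma exists_maximizer (T : {linear H -> H}) : cluster_compact T ->
  (exists x, T x != 0) ->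
  exists u : H, [/\ rnorm u = 1, 0 < rnorm (T u) &
             forall x, rnorm (T x) <= rnorm (T u) * rnorm x].
Proof.
move=> cT [x0 Tx0].
have [M M0 hM] := cluster_compact_bounded cT.
pose E := [set rnorm (T x) | x in [set x | rnorm x <= 1]].
have E0 : E !=set0 by exists (rnorm (T 0)); exists 0 => //=; rewrite rnorm0.
have Eb : has_ubound E.
  exists M => _ [x /= x1 <-]; apply: le_trans (hM x) _.
  by rewrite ger_pMr.
pose s := sup E.
have sub x : rnorm x <= 1 -> rnorm (T x) <= s.
  by move=> x1; apply: ub_le_sup => //; exists x.
have sT x : rnorm (T x) <= s * rnorm x.
  have [->|xn0] := eqVneq x 0; first by rewrite linear0 !rnorm0 mulr0.
  rewrite {1}[x]normalizeK linearZ rnormZ rnorm_real.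
  rewrite ger0_norm ?rnorm_ge0 // mulrC ler_wpM2r ?rnorm_ge0 //.
  by rewrite sub // rnorm_normalize.
have s0 : 0 < s.
  have := sT x0; rewrite leNgt; apply: contraNT; rewrite -leNgt => s_le0.
  by apply: (@le_lt_trans _ _ 0); rewrite ?rnorm_gt0 // mulr_le0_ge0 ?rnorm_ge0.
have i0 n : 0 < n.+1%:R^-1 :> R by rewrite invr_gt0 ltr0n.
have hx n : exists x, rnorm x <= 1 /\ s - n.+1%:R^-1 < rnorm (T x).
  have [_ [x /= x1 <-] h] := sup_adherent (i0 n) (conj E0 Eb).
  by exists x.
have [w hw] := choice hx.
have [y hy] := cT w (fun n => (hw n).1).
have hv n : exists x, [/\ rnorm x <= 1, s - n.+1%:R^-1 < rnorm (T x) &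
    rnorm (T x - y) < n.+1%:R^-1].
  have [m nm h] := hy n.+1%:R^-1 n (i0 n).
  exists (w m); split=> //; first exact: (hw m).1.
  apply: le_lt_trans (hw m).2; rewrite lerD2l lerN2 lef_pV2 ?posrE ?ltr0n //.
  by rewrite ler_nat ltnS.
have [v hv'] := choice hv.
have sy : s <= rnorm y.
  apply/ler_addgt0Pr => eps e0.
  have [n /(_ n (leqnn n)) hn] := small_inv (divr_gt0 e0 (ltr0Sn R 1)).
  have [v1 v2 v3] := hv' n; have := rnorm_sub (T (v n)) y.
  by move: v2 v3 hn; set d := n.+1%:R^-1; set t := rnorm (T _); set q := rnorm (_ - y); lra.
(* the parallelogram law makes a maximizing sequence Cauchy *)
have par n m : (n <= m)%N -> rnorm (v m - v n) ^+ 2 <= 8 / s * n.+1%:R^-1.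
  move=> nm; have [v1 v2 v3] := hv' n; have [w1 w2 w3] := hv' m.
  have mn : m.+1%:R^-1 <= n.+1%:R^-1 :> R by rewrite lef_pV2 ?posrE ?ltr0n // ler_nat ltnS.
  set d := n.+1%:R^-1 in v2 v3 mn *; have d0 : 0 < d by rewrite invr_gt0.
  have h1 : 2 * s - 2 * d <= rnorm (T (v m + v n)).
    have := rnorm_sub (y + y) (T (v m + v n)).
    have -> : rnorm (y + y) = 2 * rnorm y.
      rewrite -mulr2n -scaler_nat rnormZ; congr (_ * _).
      by rewrite -(rmorph_nat (real_complex R) 2) rnorm_real ger0_norm.
    have := rnormD (y - T (v m)) (y - T (v n)).
    rewrite addrACA -opprD -linearD ![rnorm (y - T (v _))]rnormB.
    move: mn w3 v3 sy; set dm := m.+1%:R^-1; set q1 := rnorm y.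
    set q2 := rnorm (T _ - _); set q3 := rnorm (T _ - _).
    set q4 := rnorm _; set q5 := rnorm _; lra.
  have h2 := le_trans h1 (sT _).
  have h3 : 2 - 2 * (d / s) <= rnorm (v m + v n).
    rewrite -(ler_pM2l s0) mulrBr mulrCA [s * (d / s)]mulrC divfK ?gt_eqF //; lra.
  have ds : 0 < d / s by rewrite divr_gt0.
  have a0 := rnorm_ge0 (v n); have b0 := rnorm_ge0 (v m); have c0 := rnorm_ge0 (v m + v n).
  rewrite parallelogram -mulrA [s^-1 * d]mulrC.
  (* With t = d / s, the bound 4 - (2 - 2 t)^2 <= 8 t serves for t <= 1; beyond that 4 <= 8 t is
     enough. *)
  have [le1|gt1] := lerP (d / s) 1.
    nra.
  have : 0 <= rnorm (v m + v n) ^+ 2 by rewrite sqr_ge0.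
  nra.
have [u vu] : exists u : H, tends v u.
  apply: hilbert_complete => eps e0.
  have c0 : 0 < s * eps ^+ 2 / 8 by rewrite divr_gt0 // mulr_gt0 // exprn_gt0.
  have [N hN] := small_inv c0; exists N => n Nn.
  rewrite -(@ltr_pXn2r _ 2) ?nnegrE ?rnorm_ge0 ?ltW //.
  apply: le_lt_trans (par _ _ Nn) _.
  rewrite -ltr_pdivlMl ?divr_gt0 //; apply: lt_le_trans (hN N (leqnn N)) _.
  by rewrite invf_div mulrAC.
have Tu : T u = y.
  apply: (rnorm_lim_le hM vu) => eps e0.
  have [N hN] := small_inv e0; exists N => n Nn; have [_ _ h] := hv' n.
  exact: lt_trans h (hN n Nn).
have u1 : rnorm u <= 1.
  apply/ler_addgt0Pr => eps e0; have [N hN] := vu _ e0.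
  have [v1 _ _] := hv' N; have := rnorm_sub u (v N); have := hN _ (leqnn N).
  rewrite rnormB; lra.
have yE : rnorm y = s by apply/eqP; rewrite eq_le sy andbT -Tu sub.
exists u; rewrite Tu yE; split=> //.
apply/eqP; rewrite eq_le u1 /= -(ler_pM2l s0) mulr1 -{1}yE -Tu; exact: sT.
Qed.

Lemma maximizer_ip (T : {linear H -> H}) (u : H) :
  rnorm u = 1 -> (forall x, rnorm (T x) <= rnorm (T u) * rnorm x) ->
  forall v, '[T u, T v] = (rnorm (T u) ^+ 2)%:C * '[u, v].
Proof.
move=> u1 hT v; set s := rnorm (T u).
pose h := '[T u, T v] - (s ^+ 2)%:C * '[u, v].
suff h0 : h = 0 by apply/eqP; rewrite -subr_eq0 -/h h0.
pose A := s ^+ 2 * rnorm v ^+ 2 - rnorm (T v) ^+ 2.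
have key (t : R) : 0 <= A + 2 * (t * rnorm h ^+ 2).
  (* In |T (c u + v)|^2 <= s^2 |c u + v|^2 the terms in |c|^2 cancel. With this [c] the rest is
     affine in the real [t], so its slope must vanish. *)
  pose c := - (t%:C * (h^*)%C).
  have := hT (c *: u + v); rewrite -(@ler_pXn2r _ 2) ?nnegrE ?mulr_ge0 ?rnorm_ge0 //.
  rewrite exprMn linearP !rnormD2 !ipZl !rnormZ u1 -/s.
  have -> : '[T u, T v] = h + (s ^+ 2)%:C * '[u, v] by rewrite subrK.
  rewrite mulrDr ReD.
  have -> : c * h = (- (t * rnorm h ^+ 2))%:C.
    by rewrite CrN CrM -mulC_conj /c mulNr -mulrA [_^*%C * _]mulrC.
  rewrite [c * (_ * _)]mulrCA Re_realM /= /A; lra.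
have A0 : 0 <= A by have := key 0; rewrite mul0r mulr0 addr0.
apply/eqP; rewrite -rnorm_eq0 -sqrf_eq0 eq_le sqr_ge0 andbT leNgt.
apply/negP => n0; have := key (- (A + 1) / (2 * rnorm h ^+ 2)).
set n := rnorm h ^+ 2 in n0 *.
have -> : A + 2 * (- (A + 1) / (2 * n) * n) = -1.
  by field; rewrite gt_eqF.
lra.
Qed.

End Sequences.

(** * Approximate eigenvectors of compact operators *)

Section ApproximateEigenvectors.
Variables (R : realType) (H : hilbertType R).
Implicit Types (x y z : H) (a b : R[i]).

Lemma best_multiple y w a : w != 0 ->
  rnorm (y - ('[y, w] / '[w, w]) *: w) <= rnorm (y - a *: w).
Proof.
move=> w0; set c := _ / _.
have ww : '[w, w] != 0.
  by rewrite ipxx -[0]/((0 : R)%:C) (inj_eq (@complexI R)) sqrf_eq0 rnorm_eq0.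
have -> : y - a *: w = (y - c *: w) + (c - a) *: w.
  by rewrite scalerBl addrA subrK.
have ort : '[y - c *: w, (c - a) *: w] = 0.
  by rewrite ipZr ipBl ipZl divfK // subrr mulr0.
by rewrite -(@ler_pXn2r _ 2) ?nnegrE ?rnorm_ge0 // (pythagoras ort) lerDl sqr_ge0.
Qed.

(** With [a] the inverse of an eigenvalue, a bound on [a] keeps the eigenvalue away from 0. If T x
    accumulates at [y], then x is close to a T x, hence to a y, and applying T shows that [y] is
    close to a T y. Projecting [y] on the line of T y makes the multiple exact without extracting a
    limit of the scalars. *)
Lemma eigenvector_of_approximate (T : {linear H -> H}) (r : R) :
  cluster_compact T -> 0 <= r ->
  (forall eps : R, 0 < eps -> exists x a,
    [/\ rnorm x = 1, rnorm a <= r + eps & rnorm (x - a *: T x) <= eps]) ->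
  exists y a, [/\ y != 0, rnorm a <= r & y = a *: T y].
Proof.
move=> cT r0 happ.
have [M M0 hM] := cluster_compact_bounded cT.
have hx n : exists p : H * R[i], [/\ rnorm p.1 = 1, rnorm p.2 <= r + n.+1%:R^-1 &
    rnorm (p.1 - p.2 *: T p.1) <= n.+1%:R^-1].
  have [|x [a h]] := happ n.+1%:R^-1; first by rewrite invr_gt0 ltr0n.
  by exists (x, a).
have [p hp] := choice hx.
have p1 n : rnorm (p n).1 <= 1 by have [-> _ _] := hp n.
have [y hy] := cT _ p1.
(* For eps <= 1, |x - a y| <= eps + (r + eps) eps <= (2 + r) eps. Applying [T] multiplies this by
   [M], and |T x - y| adds one more eps. *)
pose K := 1 + M * (2 + r).
have K1 : 1 <= K by rewrite lerDl mulr_ge0 ?addr_ge0 // ltW.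
(* near the cluster point [y], the vector [p n] is close to a multiple of [y] *)
have near (eps : R) : 0 < eps -> eps <= 1 -> exists x a,
    [/\ rnorm x = 1, rnorm a <= r + eps, rnorm (T x - y) <= eps &
        rnorm (x - a *: y) <= (2 + r) * eps].
  move=> e0 e1; have [N hN] := small_inv e0.
  have [n Nn h] := hy eps N e0; have {hN} hN := hN n Nn.
  have [x1 a1 xa] := hp n; exists (p n).1, (p n).2; split=> //.
  - by apply: le_trans a1 _; rewrite lerD2l ltW.
  - exact: ltW.
  have := rnorm_tri ((p n).2 *: T (p n).1) (p n).1 ((p n).2 *: y).
  rewrite -scalerBr rnormZ => /le_trans; apply.
  have := rnorm_ge0 (p n).2; have := rnorm_ge0 (T (p n).1 - y).
  move: xa h hN a1; set q1 := rnorm _; set q2 := rnorm _; set d := _^-1.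
  set q3 := rnorm _ => ? ? ? ? ? ?.
  have : q3 * q2 <= (r + d) * eps by rewrite ler_pM // ltW.
  nra.
have y0 : y != 0.
  (* If [y] were 0, this eps would give |x| <= 1/2 for a unit vector x. *)
  apply/eqP => y0; pose eps : R := (2 * (2 + r))^-1.
  have r2 : 0 < 2 * (2 + r) by lra.
  have [|| x [a [x1 _ _]]] := near eps; first by rewrite invr_gt0.
    rewrite invf_le1 //; lra.
  rewrite y0 scaler0 subr0 x1 /eps invfM mulrCA divff ?gt_eqF //; lra.
have near2 (eps : R) : 0 < eps -> eps <= 1 -> exists2 a,
    rnorm a <= r + eps & rnorm (y - a *: T y) <= K * eps.
  move=> e0 e1; have [x [a [x1 a1 Tx xa]]] := near eps e0 e1.
  exists a => //; have := rnorm_tri (T x) y (a *: T y).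
  rewrite (rnormB y (T x)) => /le_trans; apply; rewrite mulrDl mul1r lerD //.
  have -> : T x - a *: T y = T (x - a *: y) by rewrite opB opZ.
  apply: le_trans (hM _) _.
  by rewrite -mulrA ler_wpM2l // ltW.
have Ty0 : T y != 0.
  apply/eqP => Ty0; pose eps := Num.min 1 (rnorm y / (2 * K)).
  have y0' : 0 < rnorm y by rewrite rnorm_gt0.
  have K0 : 0 < K by lra.
  have e0 : 0 < eps by rewrite lt_min ltr01 divr_gt0 // mulr_gt0.
  have [|a _] := near2 eps e0; first by rewrite ge_min lexx.
  rewrite Ty0 scaler0 subr0; apply/negP; rewrite -ltNge.
  apply: (@le_lt_trans _ _ (rnorm y / 2)); last by lra.
  rewrite mulrC -ler_pdivlMr // -mulrA -invfM ge_min; apply/orP; right.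
  by rewrite lexx.
pose c := '[y, T y] / '[T y, T y].
have yE : y = c *: T y.
  apply/eqP; rewrite -subr_eq0 -rnorm_eq0 eq_le rnorm_ge0 andbT.
  apply/ler_addgt0Pr => eps e0; rewrite add0r.
  have K0 : 0 < K by lra.
  pose d := Num.min 1 (eps / K).
  have d0 : 0 < d by rewrite lt_min ltr01 divr_gt0.
  have [|a _ ha] := near2 d d0; first by rewrite ge_min lexx.
  apply: le_trans (best_multiple y a Ty0) _; apply: le_trans ha _.
  by rewrite mulrC -ler_pdivlMr // ge_min lexx orbT.
exists y, c; split=> //.
apply/ler_addgt0Pr => eps e0.
have t0 : 0 < rnorm (T y) by rewrite rnorm_gt0.
have K0 : 0 < K by lra.
have Kt : 0 < 1 + K / rnorm (T y) by rewrite addr_gt0 // divr_gt0.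
(* From |c| |T y| = |y| <= (r + d) |T y| + K d follows |c| <= r + d (1 + K / |T y|). *)
pose d := Num.min 1 (eps / (1 + K / rnorm (T y))).
have d0 : 0 < d by rewrite lt_min ltr01 divr_gt0.
have d1 : d * (1 + K / rnorm (T y)) <= eps.
  by rewrite -ler_pdivlMr // ge_min lexx orbT.
have [|a a1 ha] := near2 d d0; first by rewrite ge_min lexx.
rewrite -(ler_pM2r t0) -rnormZ -yE.
have := rnorm_sub y (a *: T y); rewrite rnormZ.
have : rnorm a * rnorm (T y) <= (r + d) * rnorm (T y) by rewrite ler_wpM2r ?rnorm_ge0.
have : d * (1 + K / rnorm (T y)) * rnorm (T y) <= eps * rnorm (T y) by rewrite ler_wpM2r ?rnorm_ge0.
rewrite -mulrA mulrDl mul1r divfK ?gt_eqF //.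
lra.
Qed.

End ApproximateEigenvectors.

(** * Flags and generalized eigenspaces *)

Section Dimension.
Variables (R : realType) (V : lmodType R[i]).
Implicit Types (E F : set V) (x g : V).

Lemma independent_card_le m n (e : 'I_m -> V) (f : 'I_n -> V) :
  linearly_independent e -> (forall i, linear_span f (e i)) -> (m <= n)%N.
Proof.
move=> eI ef; rewrite leqNgt; apply/negP => nm.
have [c hc] := choice ef.
pose M := \matrix_(i < m, j < n) c i j.
have : kermx M != 0.
  rewrite kermx_eq0 /row_free neq_ltn; apply/orP; left.
  exact: leq_ltn_trans (rank_leq_col M) nm.
case/rowV0Pn => v /sub_kermxP vM; apply/negP; rewrite negbK; apply/eqP/rowP => i.
rewrite mxE; apply: (eI (fun i => v 0 i)).
under eq_bigr => k _ do rewrite hc scaler_sumr.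
rewrite exchange_big /= big1 // => j _.
under eq_bigr => k _ do rewrite scalerA.
rewrite -scaler_suml; have /rowP/(_ j) := vM; rewrite !mxE => h.
suff -> : \sum_(i < m) v 0 i * c i j = 0 by rewrite scale0r.
by rewrite -[RHS]h; apply: eq_bigr => k _; rewrite mxE.
Qed.

Lemma has_dim_independent_le E m n (e : 'I_n -> V) : has_dim E m ->
  linearly_independent e -> (forall i, E (e i)) -> (n <= m)%N.
Proof.
by move=> [f [_ ->]] eI eE; apply: independent_card_le eI eE.
Qed.

Lemma linear_span_gen n (e : 'I_n -> V) i : linear_span e (e i).
Proof.
exists (fun j => (j == i)%:R); rewrite (bigD1 i) //= eqxx scale1r big1 ?addr0 //.
by move=> j /negbTE ->; rewrite scale0r.
Qed.

Lemma has_dim_subset E F m n : has_dim E m -> has_dim F n -> E `<=` F -> (m <= n)%N.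
Proof.
move=> [e [eI ->]] dF EF; apply: has_dim_independent_le dF eI _ => i.
exact/EF/linear_span_gen.
Qed.

Lemma has_dim0 : has_dim [set (0 : V)] 0.
Proof.
exists (fun i => 0); split=> [c _ [] //|].
apply/seteqP; split=> x /= => [->|[c ->]]; last by rewrite big_ord0.
by exists (fun=> 0); rewrite big_ord0.
Qed.

Lemma has_dimS E m g : has_dim E m -> ~ E g ->
  has_dim [set x | exists y c, E y /\ x = y + c *: g] m.+1.
Proof.
move=> [e [eI EE]] Eg.
pose f (i : 'I_m.+1) := oapp e g (unlift ord_max i).
have fw (i : 'I_m) : f (widen_ord (leqnSn m) i) = e i.
  rewrite /f (_ : widen_ord _ _ = lift ord_max i) ?liftK //.
  by apply/val_inj; rewrite /= /bump leqNgt ltn_ord.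
have fm : f ord_max = g by rewrite /f unlift_none.
exists f; split.
  move=> c; rewrite big_ord_recr /= fm.
  under eq_bigr => i _ do rewrite fw.
  move=> h; have cm0 : c ord_max = 0.
    apply: contrapT => /eqP cm; apply: Eg; rewrite EE.
    exists (fun i => - (c ord_max)^-1 * c (widen_ord (leqnSn m) i)).
    under eq_bigr => i _ do rewrite -scalerA.
    rewrite -scaler_sumr; move/eqP: h; rewrite addr_eq0 => /eqP ->.
    by rewrite scaleNr scalerN opprK scalerA mulVf // scale1r.
  move: h; rewrite cm0 scale0r addr0 => /eI c0 i.
  have [->|im] := eqVneq i ord_max; first exact: cm0.
  rewrite -val_eqE /= in im.
  have il : (i < m)%N by rewrite ltn_neqAle im -ltnS ltn_ord.
  by rewrite -(c0 (Ordinal il)); congr c; apply/val_inj.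
apply/seteqP; split=> x /=.
  move=> [y [c [Ey ->]]]; move: Ey; rewrite EE => -[d ->].
  exists (fun i => oapp d c (unlift ord_max i)).
  rewrite big_ord_recr /= fm unlift_none /=; congr (_ + _).
  apply: eq_bigr => i _; rewrite fw (_ : widen_ord _ _ = lift ord_max i) ?liftK //.
  by apply/val_inj; rewrite /= /bump leqNgt ltn_ord.
move=> [c ->]; rewrite big_ord_recr /= fm.
exists (\sum_(i < m) c (widen_ord (leqnSn m) i) *: e i), (c ord_max); split.
  by rewrite EE; exists (fun i => c (widen_ord (leqnSn m) i)).
by congr (_ + _); apply: eq_bigr => i _; rewrite fw.
Qed.

End Dimension.

Section Flags.
Variables (R : realType) (H : hilbertType R) (T : {linear H -> H}).
Implicit Types (x y z g : H) (a b w mu : R[i]) (e : nat -> H) (lam : nat -> R[i]).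

Definition shift_op w : H -> H := fun y => T y - w *: y.

Lemma shift_op_is_linear w : linear (shift_op w).
Proof.
move=> a x y; rewrite /shift_op opD opZ scalerDr scalerBr !scalerA mulrC.
by rewrite opprD addrACA.
Qed.
HB.instance Definition _ w := GRing.isLinear.Build R[i] H H *:%R (shift_op w)
  (shift_op_is_linear w).

Lemma shift_opP w a x y : shift_op w (a *: x + y) = a *: shift_op w x + shift_op w y.
Proof. exact: linearP. Qed.

Lemma iter_shift_linear w k : linear (iter k (shift_op w)).
Proof. by elim: k => [//|k IH] a x y /=; rewrite IH linearP. Qed.

Local Notation gen w := (generalized_eigenspace T w).

Lemma iter_shift0 w k : iter k (shift_op w) 0 = 0.
Proof. by elim: k => [//|k IH] /=; rewrite IH linear0. Qed.

Lemma gen0 w : gen w 0.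
Proof. by exists 0%N. Qed.

Lemma gen_lin w a x y : gen w x -> gen w y -> gen w (a *: x + y).
Proof.
move=> [k kx] [l ly]; exists (k + l)%N.
rewrite -/(shift_op w) in kx ly *.
rewrite iter_shift_linear [iter _ _ y]iterD ly iter_shift0 addr0.
by rewrite addnC iterD kx iter_shift0 scaler0.
Qed.

Lemma gen_shift w x : gen w (shift_op w x) -> gen w x.
Proof. by move=> [k kx]; exists k.+1; rewrite iterSr. Qed.

(** A Schur basis of an invariant subspace: T - lam_j sends e_j into the span of the earlier
    vectors, so T is triangular with diagonal [lam]. *)
Definition flag lam e n : Prop := orthonormal_upto e n /\
  forall j, (j < n)%N -> oproj e j (shift_op (lam j) (e j)) = shift_op (lam j) (e j).

Lemma flagW lam e m n : (m <= n)%N -> flag lam e n -> flag lam e m.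
Proof.
move=> mn [ho h]; split; first exact: orthonormal_uptoW ho.
by move=> j jm; apply: h; apply: leq_trans mn.
Qed.

Lemma eq_flag lam lam' e e' n : (forall i, (i < n)%N -> lam i = lam' i) ->
  (forall i, (i < n)%N -> e i = e' i) -> flag lam e n -> flag lam' e' n.
Proof.
move=> ll ee [ho h]; split; first exact: eq_orthonormal ho.
move=> j jn; rewrite -ll // -ee // -(@eq_oproj _ _ e) ?h //.
by move=> i ij; rewrite ee // (ltn_trans ij).
Qed.

Lemma oproj_lin e n a x y : oproj e n x = x -> oproj e n y = y ->
  oproj e n (a *: x + y) = a *: x + y.
Proof. by move=> hx hy; rewrite linearP /= hx hy. Qed.

Lemma flag_op_e lam e n i : flag lam e n -> (i < n)%N ->
  oproj e n (T (e i)) = T (e i).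
Proof.
move=> [ho h] il; have -> : T (e i) = lam i *: e i + shift_op (lam i) (e i).
  by rewrite /shift_op addrC subrK.
by rewrite oproj_lin ?oproj_e // (oproj_span ho (ltnW il)) ?h.
Qed.

Lemma flag_op lam e n x : flag lam e n -> oproj e n x = x -> oproj e n (T x) = T x.
Proof.
move=> fl xW.
have -> : T x = \sum_(i < n) '[x, e i] *: T (e i).
  by rewrite -{1}xW op_sum; apply: eq_bigr => i _; rewrite opZ.
by rewrite linear_sum; apply: eq_bigr => i _; rewrite linearZ /= (flag_op_e fl).
Qed.

Lemma flag_shift lam e n w x : flag lam e n -> oproj e n x = x ->
  oproj e n (shift_op w x) = shift_op w x.
Proof.
by move=> fl xW; rewrite /shift_op addrC -scaleNr oproj_lin // (flag_op fl).
Qed.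

Lemma oproj_lead e n x : orthonormal_upto e n.+1 -> oproj e n.+1 x = x ->
  '[x, e n] = 0 -> oproj e n x = x.
Proof. by move=> ho; rewrite oprojS => xW x0; rewrite -{2}xW x0 scale0r addr0. Qed.

Lemma ip_lead0 e n x : orthonormal_upto e n.+1 -> oproj e n x = x -> '[x, e n] = 0.
Proof.
move=> ho <-; rewrite ip_suml big1 // => i _.
by rewrite ipZl ho ?ltn_eqF ?mulr0 // ltnS ltnW.
Qed.

(** On the one-dimensional quotient W_(n+1) / W_n, T - w is multiplication by lam_n - w. *)
Lemma flag_lead lam e n w x : flag lam e n.+1 -> oproj e n.+1 x = x ->
  '[shift_op w x, e n] = (lam n - w) * '[x, e n].
Proof.
move=> fl xW; have [ho h] := fl; have fln := flagW (leqnSn n) fl.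
rewrite -{1}xW oprojS addrC linearP /= ipDl ipZl.
rewrite (@ip_lead0 e n (shift_op w (oproj e n x))) //; last first.
  apply: (flag_shift _ fln); rewrite oproj_id //; exact: orthonormal_uptoW ho.
have -> : shift_op w (e n) = (lam n - w) *: e n + shift_op (lam n) (e n).
  by rewrite /shift_op scalerBl [RHS]addrC addrA subrK.
by rewrite ipDl ipZl (ip_lead0 ho (h n (ltnSn n))) ho // eqxx mulr1 !addr0 mulrC.
Qed.

Lemma flag_gen_lead lam e n w x : flag lam e n.+1 -> oproj e n.+1 x = x ->
  gen w x -> lam n != w -> oproj e n x = x.
Proof.
move=> fl xW [k kx] lw; apply: oproj_lead => //; first exact: fl.1.
have : '[iter k (shift_op w) x, e n] = (lam n - w) ^+ k * '[x, e n] /\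
    oproj e n.+1 (iter k (shift_op w) x) = iter k (shift_op w) x.
  elim: {kx} k => [|k [IH1 IH2]]; first by rewrite mul1r.
  by rewrite /= (flag_lead _ fl) // IH1 (flag_shift _ fl) // exprS mulrA.
rewrite -/(shift_op w) in kx.
rewrite kx ip0l => -[/esym/eqP + _]; rewrite mulf_eq0 expf_eq0 subr_eq0 (negbTE lw) andbF.
by move=> /eqP.
Qed.

Lemma count_iota0S (p : pred nat) n :
  count p (iota 0 n.+1) = (count p (iota 0 n) + p n)%N.
Proof. by rewrite -addn1 iotaD count_cat /= addn0. Qed.

(* [W_n] is the sum of its generalized [w]-eigenspace and of the range of [T - w];
   this is what lifts a diagonal entry [lam n = w] to a generalized eigenvector. *)
Lemma flag_gen lam e n w : flag lam e n ->
  (forall y, oproj e n y = y -> exists a b : H,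
    [/\ oproj e n a = a, gen w a, oproj e n b = b & y = a + shift_op w b]) /\
  has_dim [set x | oproj e n x = x /\ gen w x]
    (count (fun i => lam i == w) (iota 0 n)).
Proof.
elim: n => [|n IH] fl.
  split=> [y|].
    rewrite oproj0 => <-; exists 0, 0; split=> //; rewrite ?oproj0 //.
      exact: gen0.
    by rewrite linear0 addr0.
  rewrite (_ : [set x | _] = [set 0]); first exact: has_dim0.
  apply/seteqP; split=> x /=; first by rewrite oproj0 => -[<-].
  by move=> ->; rewrite oproj0; split=> //; exact: gen0.
have [ho h] := fl; have fln := flagW (leqnSn n) fl.
have [IH1 IH2] := IH fln; rewrite count_iota0S.
have up x : oproj e n x = x -> oproj e n.+1 x = x.
  exact: (oproj_span ho (leqnSn n)).
have eW : oproj e n.+1 (e n) = e n by rewrite oproj_e.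
have dec y : oproj e n.+1 y = y -> y = '[y, e n] *: e n + oproj e n y /\
    oproj e n (oproj e n y) = oproj e n y.
  move=> yW; rewrite {1}addrC -oprojS yW; split=> //.
  by rewrite oproj_id //; exact: fln.1.
have [a0 [b0 [a0W a0g b0W E0]]] := IH1 _ (h n (ltnSn n)).
have [lw|lw] := eqVneq (lam n) w.
  (* Subtracting [b0] from [e n] leaves (T - w) g = a0, a generalized eigenvector. So [g] is one as
     well, and it lies outside W_n: this is the extra dimension. *)
  rewrite lw in E0; pose g := (-1) *: b0 + e n.
  have gW : oproj e n.+1 g = g by rewrite /g oproj_lin // up.
  have gg : gen w g.
    by apply: gen_shift; rewrite linearP /= E0 scaleN1r addrCA addNr addr0.
  have g1 : '[g, e n] = 1.
    by rewrite ipDl ipZl (ip_lead0 ho b0W) mulr0 add0r ho // eqxx.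
  split=> [y yW|].
    have [yE yW'] := dec y yW.
    have [a' [b' [a'W a'g b'W E']]] := IH1 _ yW'.
    (* Since [e n] is g + b0, the vector [b0] has to be decomposed in its turn. *)
    have [a1 [b1 [a1W a1g b1W E1]]] := IH1 _ b0W.
    set c := '[y, e n] in yE.
    exists (c *: (1 *: g + a1) + a'), (c *: b1 + b'); split.
    - by apply: oproj_lin; [apply: oproj_lin => //; apply: up | apply: up].
    - by do 2!apply: gen_lin => //.
    - by rewrite oproj_lin ?up.
    have -> : y = c *: (1 *: g + b0) + oproj e n y.
      by rewrite {1}yE /g scaleN1r scale1r addrAC addNr add0r.
    by rewrite E1 E' shift_opP !scale1r (addrA g) scalerDr addrACA.
  rewrite addn1; have gn : ~ [set x | oproj e n x = x /\ gen w x] g.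
    move=> [gn _]; have := ip_lead0 ho gn; rewrite g1 => /eqP.
    by rewrite oner_eq0.
  have := has_dimS IH2 gn; congr has_dim; apply/seteqP; split=> x /=.
    move=> [y [c [[yW yg] ->]]]; rewrite addrC; split; first by rewrite oproj_lin // up.
    exact: gen_lin.
  move=> [xW xg]; exists (- '[x, e n] *: g + x), '[x, e n]; split; last first.
    by rewrite scaleNr addrC addNKr.
  split; last exact: gen_lin.
  apply: oproj_lead => //; first by rewrite oproj_lin.
  by rewrite ipDl ipZl g1 mulr1 addNr.
split=> [y yW|].
  have [yE yW'] := dec y yW.
  have [a' [b' [a'W a'g b'W E']]] := IH1 _ yW'.
  have lw0 : lam n - w != 0 by rewrite subr_eq0.
  set c := '[y, e n] in yE; pose d := c / (lam n - w).
  (* By [E0], (lam_n - w) e_n = (T - w) (e_n - b0) - a0; the factor [d] turns the left side into the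
     component of [y] along [e n]. *)
  exists ((- d) *: a0 + a'), (d *: ((-1) *: b0 + e n) + b'); split.
  - by rewrite oproj_lin // up.
  - exact: gen_lin.
  - by rewrite !oproj_lin // up.
  have E : (lam n - w) *: e n = shift_op w (e n) - shift_op (lam n) (e n).
    by rewrite /shift_op opprB scalerBl [RHS]addrC addrA subrK.
  have -> : y = d *: ((lam n - w) *: e n) + oproj e n y.
    by rewrite scalerA divfK.
  have A (p q r : H) : p - (q + r) = - q + (- r + p) by rewrite opprD addrCA [p + _]addrC.
  by rewrite E E0 E' !shift_opP scaleNr scaleN1r A scalerDr scalerN addrACA.
rewrite addn0; move: IH2; congr has_dim; apply/seteqP; split=> x /=.
  by move=> [xW xg]; split=> //; exact: up.
by move=> [xW xg]; split=> //; exact: flag_gen_lead xg lw.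
Qed.

End Flags.

(** * Enumerations of eigenvalues *)

Section Counting.
Local Open Scope card_scope.

Lemma card_count (p : pred nat) n :
  [set k | (k < n)%N /\ p k] #= `I_(count p (iota 0 n)).
Proof.
elim: n => [|n IH].
  by rewrite /= II0 card_eq0; apply/eqP/seteqP; split=> k // [].
rewrite count_iota0S; have [pn|pn] := boolP (p n); last first.
  rewrite addn0; move: IH; congr card_eq; apply/seteqP; split=> k /=.
    by move=> [kn pk]; split=> //; rewrite ltnS ltnW.
  move=> [kn pk]; split=> //; rewrite ltn_neqAle -ltnS kn andbT.
  by apply: contraNneq pn => <-.
rewrite addn1; apply/eq_cardSP; exists n => //.
move: IH; congr card_eq; apply/seteqP; split=> k /=.
  by move=> [kn pk]; split; [split=> //; rewrite ltnS ltnW | apply/eqP; rewrite ltn_eqF].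
by move=> [[kn pk] /eqP nk]; split=> //; rewrite ltn_neqAle nk -ltnS.
Qed.

Lemma card_count_le (T : eqType) (lam : nat -> T) (z : T) m n :
  [set k | lam k = z] #= `I_m -> (count (fun i => lam i == z) (iota 0 n) <= m)%N.
Proof.
move=> hm; rewrite -card_le_II -(card_le_eqr hm).
rewrite -(card_le_eql (card_count (fun i => lam i == z) n)).
by apply: subset_card_le => k [_ /eqP].
Qed.

Lemma card_count_eq (T : eqType) (lam : nat -> T) (z : T) n :
  (forall k, (n <= k)%N -> lam k != z) ->
  [set k | lam k = z] #= `I_(count (fun i => lam i == z) (iota 0 n)).
Proof.
move=> hn; rewrite (_ : [set k | _] = [set k | (k < n)%N /\ lam k == z]).
  exact: card_count.
apply/seteqP; split=> k /= => [kz|[_ /eqP//]].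
split; last exact/eqP; rewrite ltnNge; apply/negP => /hn.
by rewrite kz eqxx.
Qed.

Lemma card_count_lt (T : eqType) (lam : nat -> T) (z : T) m n :
  [set k | lam k = z] #= `I_m -> (count (fun i => lam i == z) (iota 0 n) < m)%N ->
  exists2 k, (n <= k)%N & lam k = z.
Proof.
move=> hm cm; apply: contrapT => hn.
have /card_count_eq h : forall k, (n <= k)%N -> lam k != z.
  by move=> k nk; apply/eqP => kz; apply: hn; exists k.
have /card_eq_II mE : `I_m #= `I_(count (fun i => lam i == z) (iota 0 n)).
  by apply: card_eq_trans h; rewrite card_eq_sym.
by rewrite -mE ltnn in cm.
Qed.

End Counting.

(** [enumeration_flag] realizes non-zero entries only, so sequences are cut before their first zero.
    The factors lost are 1, and the modulus at the cut is that at [k]. *)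
Lemma nonzero_prefix (R : realType) (lam : nat -> R[i]) k :
  (forall n, rnorm (lam n.+1) <= rnorm (lam n)) ->
  exists n, [/\ (n <= k)%N, forall j, (j < n)%N -> lam j != 0,
    rnorm (lam n) = rnorm (lam k) &
    \prod_(j < n) (1 - lam j) = \prod_(j < k) (1 - lam j)].
Proof.
move=> mono; elim: k => [|k [n [nk l0 ln pn]]]; first by exists 0%N.
have [lk|lk] := eqVneq (lam k) 0.
  exists n; split=> //; first exact: ltnW; last first.
    by rewrite big_ord_recr /= lk subr0 mulr1.
  have := mono k; rewrite ln lk rnorm0 => h.
  by apply/eqP; rewrite eq_le rnorm_ge0.
exists k.+1; split=> // j; rewrite ltnS => jk.
rewrite -rnorm_gt0; apply: lt_le_trans (_ : rnorm (lam k) <= _); first by rewrite rnorm_gt0.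
rewrite -(subnK jk); elim: (k - j)%N => [//|d IH].
by rewrite addSn; apply: le_trans (mono _) IH.
Qed.

Section Enumerations.
Variables (R : realType) (H : hilbertType R) (T : {linear H -> H}).
Implicit Types (x y z g v : H) (a b w mu : R[i]) (e : nat -> H) (lam : nat -> R[i]).

Local Notation gen w := (generalized_eigenspace T w).

(* [(mu, v)] is an eigenpair of the compression of [T] to the orthogonal
   complement of [e 0, ..., e n.-1]. *)
Definition quotient_eigenpair e n mu v : Prop :=
  [/\ v != 0, oproj e n v = 0 & oproj e n (shift_op T mu v) = shift_op T mu v].

Lemma eq_quotient_eigenpair e f n mu v : (forall i, (i < n)%N -> e i = f i) ->
  quotient_eigenpair e n mu v -> quotient_eigenpair f n mu v.
Proof. by move=> ef [v0 pv pD]; split; rewrite -?(eq_oproj _ ef). Qed.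

Lemma flag_extend lam e n mu v : flag T lam e n -> quotient_eigenpair e n mu v ->
  flag T (set_at lam n mu) (set_at e n (normalize v)) n.+1.
Proof.
move=> [ho h] [v0 pv pD]; split.
  by apply: orthonormal_set_at => //; [exact: rnorm_normalize | rewrite linearZ /= pv scaler0].
move=> j; rewrite ltnS leq_eqVlt => /predU1P[->|jn].
  rewrite !set_atx (eq_oproj _ (set_atE e (normalize v))).
  by rewrite /normalize linearZ /= linearZ /= pD.
rewrite !set_atE // (@eq_oproj _ _ _ e) ?h // => i ij.
by rewrite set_atE // (ltn_trans ij).
Qed.

(** The iterates of T - w start outside W_n and end at 0. The part orthogonal to W_n of the last
    iterate outside W_n is the eigenvector. *)
Lemma gen_quotient_eigenpair lam e n w x : flag T lam e n -> gen w x ->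
  oproj e n x <> x -> exists v, quotient_eigenpair e n w v.
Proof.
move=> fl [k]; rewrite -/(shift_op T w); elim: k x => [|k IH] x.
  by move=> /= -> []; rewrite linear0.
rewrite iterSr => kx xW.
have [DW|DW] := pselect (oproj e n (shift_op T w x) = shift_op T w x); last exact: IH DW.
exists (x - oproj e n x); split.
- by rewrite subr_eq0 eq_sym; apply/eqP.
- by rewrite oproj_compl //; exact: fl.1.
have pW : oproj e n (oproj e n x) = oproj e n x by rewrite oproj_id //; exact: fl.1.
by rewrite addrC -scaleN1r shift_opP oproj_lin // (flag_shift _ fl).
Qed.

Lemma count_set_at lam n mu w :
  count (fun i => set_at lam n mu i == w) (iota 0 n.+1) =
  (count (fun i => lam i == w) (iota 0 n) + (mu == w))%N.
Proof.
rewrite count_iota0S set_atx; congr addn; apply: eq_in_count => i.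
by rewrite mem_iota /= add0n => il; rewrite set_atE.
Qed.

(** By [flag_gen], W_n holds only as many dimensions of the generalized eigenspace of lam_n as lam_n
    occurs before index n. The multiplicity is larger, so a generalized eigenvector lies outside W_n
    and yields the next flag vector. *)
Lemma enumeration_flag lam n : eigenvalue_enumeration T lam ->
  (forall k, (k < n)%N -> lam k != 0) -> exists e, flag T lam e n.
Proof.
move=> [_ hlam]; elim: n => [|n IH] lam0; first by exists (fun=> 0); split.
have [|e fl] := IH; first by move=> k kn; apply: lam0; rewrite ltnS ltnW.
have [m dm cm] := hlam _ (lam0 n (ltnSn n)).
have [x gx xW] : exists2 x, gen (lam n) x & oproj e n x <> x.
  apply: contrapT => no.
  have [_ dW] := flag_gen (lam n) fl.
  have := card_count_le n.+1 cm; rewrite count_iota0S eqxx addn1 ltnNge => /negP; apply.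
  apply: (has_dim_subset dm dW) => x gx; split=> //.
  by apply: contrapT => xW; apply: no; exists x.
have [v qv] := gen_quotient_eigenpair fl gx xW.
exists (set_at e n (normalize v)).
apply: eq_flag (flag_extend fl qv) => // i; rewrite ltnS leq_eqVlt => /predU1P[->|il].
  by rewrite set_atx.
by rewrite set_atE.
Qed.

(** Extending the flag by [mu] shows that its multiplicity exceeds its number of occurrences before
    [n]; hence [mu] occurs at or after [n], where moduli are at most that of lam_n. *)
Lemma enumeration_quotient_le lam e n mu v : eigenvalue_enumeration T lam ->
  flag T lam e n -> mu != 0 -> quotient_eigenpair e n mu v ->
  rnorm mu <= rnorm (lam n).
Proof.
move=> [mono hlam] fl mu0 qv.
have [m dm cm] := hlam _ mu0.
have [_ dW] := flag_gen mu (flag_extend fl qv).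
rewrite count_set_at eqxx addn1 in dW.
have [|k nk <-] := card_count_lt (n := n) cm.
  by apply: (has_dim_subset dW dm) => x [].
rewrite -(subnK nk); elim: (k - n)%N => [//|d IH].
by rewrite addSn; apply: le_trans (mono _) IH.
Qed.

(** If no quotient eigenvector for [w] is left, the whole generalized eigenspace lies in W_n, and
    [flag_gen] gives its dimension. *)
Lemma enumeration_of_flags lam :
  (forall n, rnorm (lam n.+1) <= rnorm (lam n)) ->
  (forall w, w != 0 -> exists n e, [/\ flag T lam e n,
     forall k, (n <= k)%N -> lam k != w & forall v, ~ quotient_eigenpair e n w v]) ->
  eigenvalue_enumeration T lam.
Proof.
move=> mono h; split=> // w w0; have [n [e [fl hk nq]]] := h w w0.
exists (count (fun i => lam i == w) (iota 0 n)); last exact: card_count_eq.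
have [_ ] := flag_gen w fl; congr has_dim; apply/seteqP; split=> x /= => [[]//|gx].
split=> //; apply: contrapT => xW.
by have [v /nq] := gen_quotient_eigenpair fl gx xW.
Qed.

End Enumerations.

(** * Compressions and the existence of an eigenvalue enumeration *)

Section Compression.
Variables (R : realType) (H : hilbertType R) (T : {linear H -> H}).
Implicit Types (x y z g v : H) (a b w mu : R[i]) (e : nat -> H) (lam : nat -> R[i]).

Definition ocompl e n x : H := x - oproj e n x.

Lemma ocompl_is_linear e n : linear (ocompl e n).
Proof.
by move=> a x y; rewrite /ocompl linearP /= scalerBr opprD addrACA.
Qed.
HB.instance Definition _ e n := GRing.isLinear.Build R[i] H H *:%R (ocompl e n)
  (ocompl_is_linear e n).

Lemma ocompl_fix e n x : oproj e n x = 0 -> ocompl e n x = x.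
Proof. by rewrite /ocompl => ->; rewrite subr0. Qed.

(** Acting on all of H instead of the complement keeps the type. The first n vectors are sent to 0,
    so eigenvectors for non-zero eigenvalues are those of the true compression. *)
Definition compression e n : H -> H := ocompl e n \o (T \o ocompl e n).

Lemma compression_is_linear e n : linear (compression e n).
Proof. by move=> a x y; rewrite /compression /= !linearP. Qed.
HB.instance Definition _ e n := GRing.isLinear.Build R[i] H H *:%R (compression e n)
  (compression_is_linear e n).

Lemma compression_compact e n : orthonormal_upto e n ->
  cluster_compact T -> cluster_compact (compression e n).
Proof.
move=> oe cT; apply: (@cluster_compact_comp_l _ _ _ _ 1).
  by move=> x; rewrite mul1r; apply: rnorm_oproj_compl.
by apply: cluster_compact_comp_r => // x; apply: rnorm_oproj_compl.
Qed.

Lemma quotient_eigenpairP e n mu v : orthonormal_upto e n -> mu != 0 ->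
  quotient_eigenpair T e n mu v <-> v != 0 /\ compression e n v = mu *: v.
Proof.
move=> oe mu0; split=> [[v0 pv pD]|[v0 Cv]].
  split=> //; rewrite /compression /= (ocompl_fix pv).
  have -> : T v = mu *: v + shift_op T mu v by rewrite /shift_op addrC subrK.
  by rewrite linearP /= (ocompl_fix pv) /ocompl pD subrr addr0.
have pv : oproj e n v = 0.
  apply: (scalerI mu0); rewrite scaler0 -linearZ /= -Cv /compression /=.
  exact: oproj_compl.
split=> //; rewrite /compression /= (ocompl_fix pv) /ocompl in Cv.
by rewrite /shift_op -Cv opprB addrC subrK oproj_id.
Qed.

(** Unit eigenvectors whose eigenvalues approach the supremum [s] in modulus are approximate
    solutions of y = a Q y with |a| close to 1 / s, for Q the compression; compactness provides an
    exact one. *)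
Lemma exists_maximal_eigenpair e n : orthonormal_upto e n -> cluster_compact T ->
  (exists mu v, mu != 0 /\ quotient_eigenpair T e n mu v) ->
  exists mu v, [/\ mu != 0, quotient_eigenpair T e n mu v &
    forall mu' v', mu' != 0 -> quotient_eigenpair T e n mu' v' ->
      rnorm mu' <= rnorm mu].
Proof.
move=> oe cT [mu0 [v0 [mu0n q0]]].
have cC := compression_compact oe cT.
have [M M0 hM] := cluster_compact_bounded cC.
pose E := [set t : R | exists mu v, [/\ mu != 0, quotient_eigenpair T e n mu v & t = rnorm mu]].
have E0 : E !=set0 by exists (rnorm mu0), mu0, v0.
have Eb : has_ubound E.
  exists M => _ [mu [v [mn q ->]]].
  have [vn Cv] := (quotient_eigenpairP v oe mn).1 q.
  have := hM v; rewrite /= Cv rnormZ ler_pM2r //.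
  by rewrite rnorm_gt0.
pose s := sup E.
have s0 : 0 < s.
  apply: lt_le_trans (_ : rnorm mu0 <= s); first by rewrite rnorm_gt0.
  by apply: ub_le_sup => //; exists mu0, v0.
have [|eps e0|y [a [y0 ar ya]]] := eigenvector_of_approximate (r := s^-1) cC.
- by rewrite invr_ge0 ltW.
- pose d := s - (s^-1 + eps)^-1.
  have se : 0 < s^-1 + eps by rewrite addr_gt0 ?invr_gt0.
  have d0 : 0 < d by rewrite subr_gt0 invf_plt ?posrE // ltrDl.
  have [_ [mu [v [mn q ->]]] h] := sup_adherent d0 (conj E0 Eb).
  rewrite subKr in h.
  have [vn _ _] := q; exists (normalize v), mu^-1; split.
  - exact: rnorm_normalize.
  - rewrite rnormV -[X in _ <= X]invrK lef_pV2 ?posrE ?invr_gt0 //.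
      exact: ltW.
    by rewrite rnorm_gt0.
  - have [_ Cv] := (quotient_eigenpairP v oe mn).1 q.
    have CZ c x : compression e n (c *: x) = c *: compression e n x by exact: linearZ.
    rewrite /normalize /= CZ Cv !scalerA mulrAC mulVf // mul1r subrr.
    by rewrite rnorm0 ltW.
have a0 : a != 0.
  by apply: contraNneq y0 => a0; rewrite ya a0 scale0r.
exists a^-1, y; split; first by rewrite invr_eq0.
  apply/quotient_eigenpairP => //; first by rewrite invr_eq0.
  by split=> //; rewrite {2}ya scalerA mulVf // scale1r.
move=> mu' v' m0 q'; apply: (@le_trans _ _ s); first by apply: ub_le_sup => //; exists mu', v'.
by rewrite rnormV -[s]invrK lef_pV2 ?posrE ?invr_gt0 // rnorm_gt0.
Qed.

(** Each diagonal entry is an eigenvalue of largest modulus of the compression left at its stage;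
    this is what makes the diagonal decrease. *)
Definition greedy_flag lam e n : Prop := flag T lam e n /\
  forall k, (k < n)%N -> lam k != 0 /\
    forall mu v, mu != 0 -> quotient_eigenpair T e k mu v -> rnorm mu <= rnorm (lam k).

Lemma eq_greedy_flag lam lam' e e' n : (forall i, (i < n)%N -> lam i = lam' i) ->
  (forall i, (i < n)%N -> e i = e' i) -> greedy_flag lam e n -> greedy_flag lam' e' n.
Proof.
move=> ll ee [fl h]; split; first exact: eq_flag fl.
move=> k kn; rewrite -ll //; have [l0 hk] := h k kn; split=> // mu v m0 q.
apply: hk m0 _; apply: eq_quotient_eigenpair q => i ik.
by rewrite ee // (ltn_trans ik).
Qed.

Lemma greedy_flag_extend lam e n : cluster_compact T -> greedy_flag lam e n ->
  (exists mu v, mu != 0 /\ quotient_eigenpair T e n mu v) ->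
  exists mu v, greedy_flag (set_at lam n mu) (set_at e n v) n.+1.
Proof.
move=> cT [fl h] ex; have [mu [v [m0 q qmax]]] := exists_maximal_eigenpair fl.1 cT ex.
exists mu, (normalize v); split; first exact: flag_extend.
move=> k; rewrite ltnS leq_eqVlt => /predU1P[->|kn].
  rewrite set_atx; split=> // mu' v' m0' q'; apply: qmax m0' _.
  by apply: eq_quotient_eigenpair q' => i; apply: set_atE.
rewrite set_atE //; have [l0 hk] := h k kn; split=> // mu' v' m0' q'.
apply: hk m0' _; apply: eq_quotient_eigenpair q' => i ik.
by rewrite set_atE // (ltn_trans ik).
Qed.

(** When lam_n and lam_(n+1) differ, a combination of e_n and e_(n+1) is an eigenvector for
    lam_(n+1) already at stage n, where lam_n was maximal. The coefficient [d] solves the triangular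
    2 by 2 system. *)
Lemma greedy_flag_mono lam e n : greedy_flag lam e n.+2 ->
  rnorm (lam n.+1) <= rnorm (lam n).
Proof.
move=> [fl h]; have [ho hD] := fl.
have [->//|ll] := eqVneq (lam n) (lam n.+1).
have [_ hn] := h n (ltnW (ltnSn _)); have [l0 _] := h n.+1 (ltnSn _).
set mu := lam n.+1 in ll l0 *; set D := shift_op T mu.
have fl1 := flagW (leqnSn _) fl; have fln := flagW (leqnSn _) fl1.
have DW := hD n.+1 (ltnSn _); rewrite -/mu -/D in DW.
have eW : oproj e n.+1 (e n) = e n by rewrite oproj_e //; exact: fl1.1.
have ee i j : (i < n.+2)%N -> (j < n.+2)%N -> '[e i, e j] = (i == j)%:R by exact: ho.
pose c := '[D (e n.+1), e n]; pose d := - c / (lam n - mu).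
pose v := d *: e n + e n.+1.
have vn : '[v, e n.+1] = 1.
  by rewrite ipDl ipZl !ee // ltn_eqF // mulr0 add0r eqxx.
apply: (hn _ v l0); split.
- by apply/eqP => v0; move/eqP: vn; rewrite v0 ip0l eq_sym oner_eq0.
- apply/(oproj_eq0 _ fln.1) => i il.
  have i2 : (i < n.+2)%N by rewrite (ltn_trans il) // ltnW.
  by rewrite ipDl ipZl !ee // !gtn_eqF ?mulr0 ?addr0 // ltnW.
apply: oproj_lead; first exact: fl1.1.
  by rewrite /v shift_opP oproj_lin // (flag_shift _ fl1).
rewrite /v shift_opP ipDl ipZl (flag_lead _ fl1) // ee // eqxx mulr1 -/D -/c.
by rewrite divfK ?addNr // subr_eq0.
Qed.

(** For m < n, T e_m is orthogonal to e_n, so lam_n is the inner product of T e_n - T e_m with e_n;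
    two images near the same cluster point make it small. *)
Lemma flag_eigenvalue_small lam e (eps : R) : cluster_compact T ->
  (forall n, flag T lam e n) -> 0 < eps -> exists n, rnorm (lam n) < eps.
Proof.
move=> cT fl e0.
have [|y hy] := cT e.
  by move=> n; rewrite (rnorm_unit (fl n.+1).1).
have e2 : 0 < eps / 2 by rewrite divr_gt0.
have [m _ hm] := hy _ 0%N e2; have [n mn hn] := hy _ m.+1 e2.
exists n; have [ho hD] := fl n.+1.
have -> : lam n = '[T (e n) - T (e m), e n].
  rewrite ipBl (@ip_lead0 _ _ e n (T (e m))) //; last first.
    by rewrite (flag_op_e (fl n)).
  have -> : T (e n) = lam n *: e n + shift_op T (lam n) (e n).
    by rewrite /shift_op addrC subrK.
  rewrite ipDl ipZl (ip_lead0 ho (hD n (ltnSn _))) ho // eqxx mulr1.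
  by rewrite addr0 subr0.
apply: le_lt_trans (cauchy_schwarz _ _) _; rewrite (rnorm_unit ho) // mulr1.
apply: le_lt_trans (rnorm_tri y _ _) _; rewrite (rnormB y) (splitr eps).
exact: ltrD.
Qed.

(** [eigenvalue] is a choice with default the zero sequence, so it means something only once an
    enumeration exists. It is built by extending a greedy flag as long as possible. *)
Lemma eigenvalue_enumeration_exists : cluster_compact T ->
  exists lam, eigenvalue_enumeration T lam.
Proof.
move=> cT.
have [[lam [e [n [[fl h] nq]]]]|all] := pselect (exists lam e n,
    greedy_flag lam e n /\ forall mu v, mu != 0 -> ~ quotient_eigenpair T e n mu v).
  (* The greedy construction stops: no non-zero eigenvalue is left, and zeros fill the tail. *)
  exists (fun k => if (k < n)%N then lam k else 0).
  apply: enumeration_of_flags => [k|w w0].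
    have [k1|k1] := ltnP k.+1 n; last by rewrite rnorm0 rnorm_ge0.
    rewrite (ltn_trans (ltnSn k)) //; apply: (@greedy_flag_mono _ e).
    split; first exact: flagW fl.
    by move=> j jk; apply: h; apply: leq_trans k1.
  exists n, e; split=> [|k nk|v]; last exact: nq.
    by apply: eq_flag fl => // i ->.
  by rewrite ltnNge nk /= eq_sym.
have ext (n : nat) (p : (nat -> R[i]) * (nat -> H)) :
    exists q : R[i] * H, greedy_flag p.1 p.2 n ->
      greedy_flag (set_at p.1 n q.1) (set_at p.2 n q.2) n.+1.
  have [gp|np] := pselect (greedy_flag p.1 p.2 n); last by exists (0, 0) => /np.
  have [|mu [v g]] := greedy_flag_extend cT gp; last by exists (mu, v).
  apply: contrapT => nex; apply: all; exists p.1, p.2, n; split=> // mu v m0 q.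
  by apply: nex; exists mu, v.
pose nxt n p := projT1 (choice (ext n)) p.
have hnxt n p := projT2 (choice (ext n)) p.
(* Step [m] changes indices from [m] on only, so entry [n] is final in [S n.+1]; the limit sequences
   are read on the diagonal. *)
pose fix S n := if n is m.+1 then
    (set_at (S m).1 m (nxt m (S m)).1, set_at (S m).2 m (nxt m (S m)).2)
  else ((fun=> 0) : nat -> R[i], (fun=> 0) : nat -> H).
have gS n : greedy_flag (S n).1 (S n).2 n.
  by elim: n => [|n IH]; [split; [split|] | exact: hnxt].
pose lam n := (S n.+1).1 n; pose e n := (S n.+1).2 n.
have agree n i : (i < n)%N -> (S n).1 i = lam i /\ (S n).2 i = e i.
  elim: n => [//|n IH]; rewrite ltnS leq_eqVlt => /predU1P[->//|il].
  by rewrite /= !set_atE //; exact: IH.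
have g n : greedy_flag lam e n.
  by apply: eq_greedy_flag (gS n) => i /agree[].
have fl n := (g n).1.
exists lam; have mono n : rnorm (lam n.+1) <= rnorm (lam n) by exact: greedy_flag_mono (g n.+2).
apply: enumeration_of_flags => // w w0.
(* Once |lam_n| < |w|, [w] cannot occur later, nor be an eigenvalue of the compression at stage n,
   because lam_n is maximal there. *)
have [n hn] : exists n, rnorm (lam n) < rnorm w.
  by apply: flag_eigenvalue_small fl _; rewrite ?rnorm_gt0.
have hk k : (n <= k)%N -> rnorm (lam k) < rnorm w.
  move=> nk; rewrite -(subnK nk); elim: (k - n)%N => [//|d IH].
  by rewrite addSn; apply: le_lt_trans (mono _) IH.
exists n, e; split=> // [k /hk|v q].
  by apply: contraTneq => ->; rewrite ltxx.
have [_ /(_ _ _ w0 q)] := (g n.+1).2 n (ltnSn n).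
by rewrite leNgt hn.
Qed.

End Compression.

(** * Singular values *)

Section Adjoint.
Variables (R : realType) (H : hilbertType R) (A : {linear H -> H}).
Implicit Types (x y z u v : H) (e us : nat -> H) (lam : nat -> R[i]).
Hypothesis cA : cluster_compact A.

Definition rank_one y v : H := '[v, y] *: y.

Lemma rank_one_is_linear y : linear (rank_one y).
Proof. by move=> a u v; rewrite /rank_one ipDl ipZl scalerDl scalerA. Qed.
HB.instance Definition _ y := GRing.isLinear.Build R[i] H H *:%R (rank_one y)
  (rank_one_is_linear y).

(* A maximizer [u] of the rank one operator [x |-> '[A x, y] *: y] spans the
   orthogonal complement of the kernel of the functional [x |-> '[A x, y]]. *)
Lemma adjoint_exists y : exists w, forall x, '[A x, y] = '[x, w].
Proof.
have [->|y0] := eqVneq y 0; first by exists 0 => x; rewrite !ip0r.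
pose f : {linear H -> H} := rank_one y \o A.
have cf : cluster_compact f.
  apply: (@cluster_compact_comp_l _ _ _ _ (rnorm y ^+ 2)) => // x.
  rewrite /= /rank_one rnormZ expr2 mulrAC ler_wpM2r ?rnorm_ge0 // mulrC.
  exact: cauchy_schwarz.
have [[x0 fx0]|nf] := pselect (exists x, f x != 0); last first.
  exists 0 => x; rewrite ip0r; apply/eqP; apply: contrapT => /negP h.
  by apply: nf; exists x; rewrite /= scaler_eq0 negb_or h.
have [u [u1 fu0 hmax]] := exists_maximizer cf (ex_intro _ x0 fx0).
have hip := maximizer_ip u1 hmax.
have c0 : '[A u, y] != 0.
  by apply: contraTneq fu0 => c0; rewrite /= /rank_one c0 scale0r rnorm0 ltxx.
(* [maximizer_ip] for [f] and x reads '[A u, y] '[y, A x] |y|^2 = |f u|^2 '[u, x]; [k] is the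
   resulting ratio of '[y, A x] to '[u, x]. *)
pose k := (rnorm (f u) ^+ 2)%:C / ('[A u, y] * (rnorm y ^+ 2)%:C).
have n0 : (rnorm y ^+ 2)%:C != 0 :> R[i].
  by rewrite -[0]/((0 : R)%:C) (inj_eq (@complexI R)) sqrf_eq0 rnorm_eq0.
exists (k *: u) => x; rewrite ipZr (ipC x u) -conjM.
have -> : k * '[u, x] = '[y, A x].
  apply: (mulfI (mulf_neq0 c0 n0)); rewrite mulrA /k mulrCA divff ?mulf_neq0 // mulr1.
  by rewrite -hip /= /rank_one ipZl ipZr -(ipC y (A x)) ipxx mulrA mulrAC.
exact: ipC.
Qed.

Lemma adjointP x y : '[A x, y] = '[x, adjoint A y].
Proof.
have := @xgetPex _ 0 _ (adjoint_exists y); exact.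
Qed.

Lemma adjoint_is_linear : linear (adjoint A).
Proof.
move=> a y z; apply: ip_ext => x.
rewrite ipC -adjointP ipDl ipZl ipDr ipZr !adjointP rmorphD /=.
by rewrite conjM conjcK -!(ipC _ x).
Qed.

Lemma adjoint_bounded : exists M : R, forall y, rnorm (adjoint A y) <= M * rnorm y.
Proof.
have [M M0 hM] := cluster_compact_bounded cA; exists M => y.
have [->|w0] := eqVneq (adjoint A y) 0.
  by rewrite rnorm0 mulr_ge0 ?rnorm_ge0 // ltW.
rewrite -(@ler_pM2r _ (rnorm (adjoint A y))) ?rnorm_gt0 // -expr2.
rewrite -[X in X <= _]ger0_norm ?sqr_ge0 // -rnorm_real -ipxx -adjointP.
apply: le_trans (cauchy_schwarz _ _) _; rewrite mulrAC ler_wpM2r ?rnorm_ge0 //.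
Qed.

Lemma singular_value_enumeration :
  eigenvalue_enumeration (adjoint A \o A) (Defs.eigenvalue (adjoint A \o A)).
Proof.
pose adj : {linear H -> H} := HB.pack (adjoint A)
  (GRing.isLinear.Build R[i] H H *:%R (adjoint A) adjoint_is_linear).
have [M hM] := adjoint_bounded.
have cS : cluster_compact (adj \o A) by exact: (@cluster_compact_comp_l _ _ A adj M hM cA).
have ex := eigenvalue_enumeration_exists cS.
exact: (@xgetPex _ (fun=> 0) _ ex).
Qed.

Lemma singular_value_ge0 k : 0 <= singular_value A k.
Proof. exact: sqrtr_ge0. Qed.

(** The excluded vectors form a flag of A^* A. A maximizer of A on their complement is an
    eigenvector of the compression of A^* A, with eigenvalue the square of the maximum, and
    [enumeration_quotient_le] bounds that by the next eigenvalue. *)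
Lemma singular_value_gelfand k : exists us, forall x,
  (forall i, (i < k)%N -> '[x, us i] = 0) ->
  rnorm (A x) <= singular_value A k * rnorm x.
Proof.
pose adj : {linear H -> H} := HB.pack (adjoint A)
  (GRing.isLinear.Build R[i] H H *:%R (adjoint A) adjoint_is_linear).
pose S : {linear H -> H} := adj \o A.
set lam := Defs.eigenvalue (adjoint A \o A).
have en : eigenvalue_enumeration S lam by exact: singular_value_enumeration.
have Sip x y : '[S x, y] = '[A x, A y].
  by rewrite /= ipC -adjointP -ipC.
have mono i j : (i <= j)%N -> rnorm (lam j) <= rnorm (lam i).
  move=> ij; rewrite -(subnK ij); elim: (j - i)%N => [//|d IH].
  by rewrite addSn; apply: le_trans (en.1 _) IH.
(* A non-zero lam_k is '[A^* A e_k, e_k] = |A e_k|^2 for a flag vector e_k, so the real part and the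
   square root in [singular_value] lose nothing. *)
have Re_lam : singular_value A k ^+ 2 = rnorm (lam k).
  have [l0|l0] := eqVneq (lam k) 0.
    by rewrite /singular_value -/lam l0 /= sqrtr0 expr0n rnorm0.
  have [|e fl] := enumeration_flag (n := k.+1) en.
    move=> j jk; rewrite -rnorm_gt0; apply: lt_le_trans (mono j k jk).
    by rewrite rnorm_gt0.
  have lE : lam k = (rnorm (A (e k)) ^+ 2)%:C.
    rewrite -ipxx -Sip.
    have -> : S (e k) = lam k *: e k + shift_op S (lam k) (e k).
      by rewrite /shift_op addrC subrK.
    rewrite ipDl ipZl (ip_lead0 fl.1 (fl.2 k (ltnSn k))) fl.1 //.
    by rewrite eqxx mulr1 addr0.
  by rewrite /singular_value -/lam lE sqr_sqrtr ?sqr_ge0 // rnorm_real ger0_norm ?sqr_ge0.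
have [n [nk l0 ln _]] := nonzero_prefix k en.1.
have [e fl] := enumeration_flag en l0; have ho := fl.1.
exists e => x hx; have px : oproj e n x = 0.
  by apply/(oproj_eq0 _ ho) => i il; apply: hx; apply: leq_trans nk.
pose f : {linear H -> H} := A \o ocompl e n.
have cf : cluster_compact f.
  by apply: cluster_compact_comp_r => // y; apply: rnorm_oproj_compl.
have fx : A x = f x by rewrite /= ocompl_fix.
have [nf|nf] := pselect (exists y, f y != 0); last first.
  have -> : A x = 0.
    by rewrite fx; apply/eqP; apply: contrapT => /negP h; apply: nf; exists x.
  by rewrite rnorm0 mulr_ge0 ?rnorm_ge0 ?singular_value_ge0.
have [u [u1 fu0 hmax]] := exists_maximizer cf nf.
have hip := maximizer_ip u1 hmax; set s := rnorm (f u) in fu0 hmax hip.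
have s2 : (s ^+ 2)%:C != 0 :> R[i].
  by rewrite -[0]/((0 : R)%:C) (inj_eq (@complexI R)) sqrf_eq0 gt_eqF.
(* [f] kills each e_i, so [maximizer_ip] forces '[u, e_i] = 0. *)
have pu : oproj e n u = 0.
  apply/(oproj_eq0 _ ho) => i il; apply: (mulfI s2); rewrite mulr0 -hip /=.
  by rewrite {2}/ocompl oproj_e // subrr op0 ip0r.
have fu : f u = A u by rewrite /= ocompl_fix.
have q : quotient_eigenpair S e n (s ^+ 2)%:C u.
  split=> //; first by rewrite -rnorm_gt0 u1.
  apply: (oproj_fix_of_ortho ho) => v pv.
  rewrite /shift_op ipBl ipZl Sip -fu -(ocompl_fix pv) -[A _]/(f v) hip.
  by rewrite ocompl_fix // subrr.
have := enumeration_quotient_le en fl s2 q.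
rewrite ln -Re_lam rnorm_real ger0_norm ?sqr_ge0 //.
rewrite ler_pXn2r ?nnegrE ?singular_value_ge0 ?(ltW fu0) // => le_s.
rewrite fx; apply: le_trans (hmax x) _; by rewrite ler_wpM2r ?rnorm_ge0.
Qed.

End Adjoint.

(** * Determinants of matrices *)

Section MatrixBounds.
Variable R : realType.
Local Notation C := R[i].
Local Open Scope sesquilinear_scope.
Implicit Types (s : nat -> R).

Local Notation dot := (dotmx (C := C)).

Definition vnorm n (v : 'rV[C]_n) : R := Num.sqrt (\sum_i rnorm (v 0 i) ^+ 2).

Lemma vnorm_ge0 n (v : 'rV[C]_n) : 0 <= vnorm v.
Proof. exact: sqrtr_ge0. Qed.

Lemma vnorm_sqr n (v : 'rV[C]_n) : vnorm v ^+ 2 = \sum_i rnorm (v 0 i) ^+ 2.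
Proof. by rewrite sqr_sqrtr // sumr_ge0 // => i _; rewrite sqr_ge0. Qed.

Lemma dotE n (u v : 'rV[C]_n) : dot u v = \sum_i u 0 i * ((v 0 i)^*)%C.
Proof. by rewrite dotmxE mxE; apply: eq_bigr => i _; rewrite !mxE. Qed.

Lemma dotC n (u v : 'rV[C]_n) : dot u v = ((dot v u)^*)%C.
Proof. by rewrite hermC expr0 mul1r. Qed.

Lemma dot_self n (v : 'rV[C]_n) : dot v v = (vnorm v ^+ 2)%:C.
Proof.
rewrite dotE vnorm_sqr rmorph_sum; apply: eq_bigr => i _; exact: mulC_conj.
Qed.

Lemma sqrtC_dot n (v : 'rV[C]_n) : sqrtC (dot v v) = (vnorm v)%:C.
Proof. by rewrite dot_self rmorphXn sqrCK // ler0c vnorm_ge0. Qed.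

Lemma vnorm_cauchy n (u v : 'rV[C]_n) : rnorm (dot u v) <= vnorm u * vnorm v.
Proof.
rewrite -lecR CrM -normE -!sqrtC_dot.
exact: (CauchySchwarz_sqrt (dotmx (n := n)) u v).1.
Qed.

Lemma vnormD n (u v : 'rV[C]_n) : vnorm (u + v) <= vnorm u + vnorm v.
Proof.
have := (triangle_lerif (dotmx (n := n)) u v).1.
by rewrite /= !sqrtC_dot -rmorphD lecR.
Qed.

Lemma vnormZ n a (v : 'rV[C]_n) : vnorm (a *: v) = rnorm a * vnorm v.
Proof.
rewrite /vnorm (eq_bigr (fun i => rnorm a ^+ 2 * rnorm (v 0 i) ^+ 2)).
  by rewrite -mulr_sumr sqrtrM ?sqr_ge0 // sqrtr_sqr ger0_norm ?rnorm_ge0.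
by move=> i _; rewrite mxE rnormM exprMn.
Qed.

Lemma vnorm0 n : vnorm (0 : 'rV[C]_n) = 0.
Proof. by rewrite -(scale0r 0) vnormZ rnorm0 mul0r. Qed.

Lemma vnorm_gt0 n (v : 'rV[C]_n) : v != 0 -> 0 < vnorm v.
Proof.
move=> v0; rewrite lt_def vnorm_ge0 andbT.
have : 0 < dot v v by exact: neq0_dnorm_gt0.
by rewrite dot_self ltcR; apply: contraTneq => ->; rewrite expr0n ltxx.
Qed.

Lemma vnorm_unitary n (v : 'rV[C]_n) (P : 'M[C]_n) : P \is unitarymx ->
  vnorm (v *m P) = vnorm v.
Proof.
move=> /unitarymxP PU; apply/eqP; rewrite -(@eqrXn2 _ 2) ?vnorm_ge0 //.
rewrite -(inj_eq (@complexI R)) -!dot_self !dotmxE.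
by rewrite trmx_mul map_mxM mulmxA -(mulmxA v) PU mulmx1.
Qed.

Lemma det_unitary n (P : 'M[C]_n) : P \is unitarymx -> rnorm (\det P) = 1.
Proof.
move=> /unitarymxP /(congr1 determinant).
rewrite det_mulmx det1 det_map_mx det_tr => h.
apply/eqP; rewrite -(@eqrXn2 _ 2) ?rnorm_ge0 ?ler01 // expr1n.
by rewrite -(inj_eq (@complexI R)) -mulC_conj; apply/eqP.
Qed.

(** Gram-Schmidt writes M = L B with B unitary and L lower triangular; the diagonal of L consists of
    inner products of the rows of M with unit vectors. *)
Lemma hadamard n (M : 'M[C]_n) : rnorm (\det M) <= \prod_i vnorm (row i M).
Proof.
have [B BU /forallP hB] := schmidt_subproof M (leqnn n).
pose L := M *m B^t*.
have ML : M = L *m B by rewrite mulmxKtV.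
have LE i j : L i j = dot (row i M) (row j B).
  by rewrite dotmxE !mxE; apply: eq_bigr => k _; rewrite !mxE.
have Ltrig : is_trig_mx L.
  apply/is_trig_mxP => i j ij; rewrite LE dotmxE.
  suff -> : row i M *m (row j B)^t* = 0 by rewrite mxE.
  apply/sub_kermxP; have /andP[+ _] := hB i; move/submx_trans; apply.
  apply/sumsmx_subP => k ki; rewrite genmxE; apply/sub_kermxP/rowP => l.
  have /row_unitarymxP/(_ k j) := BU; rewrite dotmxE ord1 => ->.
  rewrite mxE (_ : _ == _ = false) //; apply/negbTE.
  by rewrite -val_eqE /= ltn_eqF // (leq_ltn_trans ki).
rewrite {1}ML det_mulmx rnormM (det_unitary BU) mulr1 (det_trig Ltrig) rnorm_prod.
apply: ler_prod => i _; rewrite rnorm_ge0 LE /=.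
apply: le_trans (vnorm_cauchy _ _) _.
suff -> : vnorm (row i B) = 1 by rewrite mulr1.
apply/eqP; rewrite -(@eqrXn2 _ 2) ?vnorm_ge0 ?ler01 // expr1n.
rewrite -(inj_eq (@complexI R)) -dot_self; have /row_unitarymxP -> := BU.
by rewrite eqxx.
Qed.

(* The [k]-th Gelfand number of [v |-> v *m M] is at most [s k]. *)
Definition gelfand_mx n (M : 'M[C]_n) s : Prop := forall k,
  exists U : 'M[C]_(k, n), forall v : 'rV[C]_n, v *m U^t* = 0 ->
    vnorm (v *m M) <= s k * vnorm v.

Lemma gelfand_unitary_l n (M W : 'M[C]_n) s : W \is unitarymx ->
  gelfand_mx M s -> gelfand_mx (W *m M) s.
Proof.
move=> WU h k; have [U hU] := h k; exists (U *m W^t*) => v.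
rewrite trmx_mul map_mxM trmxCK.
move=> h0; have := hU (v *m W); rewrite -!mulmxA h0 => /(_ erefl).
by rewrite (vnorm_unitary _ WU).
Qed.

Lemma gelfand_unitary_r n (M W : 'M[C]_n) s : W \is unitarymx ->
  gelfand_mx M s -> gelfand_mx (M *m W) s.
Proof.
move=> WU h k; have [U hU] := h k; exists U => v /hU.
by rewrite mulmxA (vnorm_unitary _ WU).
Qed.

Lemma gelfand_scale n (M : 'M[C]_n) s a :
  gelfand_mx M s -> gelfand_mx (a *: M) (fun k => rnorm a * s k).
Proof.
move=> h k; have [U hU] := h k; exists U => v /hU hv.
by rewrite -scalemxAr vnormZ -mulrA ler_wpM2l ?rnorm_ge0.
Qed.

Definition orthonormal_rows n (q : nat -> 'rV[C]_n) m : Prop :=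
  forall i j, (i < m)%N -> (j < m)%N -> dot (q i) (q j) = (i == j)%:R.

(* [q j] has to be orthogonal to the [j] vectors chosen before it and to [n - j.+1]
   further vectors, which are fewer than [n] conditions. *)
Lemma adapted_basis n (M : 'M[C]_n) s (q0 : nat -> 'rV[C]_n) m0 m :
  gelfand_mx M s -> orthonormal_rows q0 m0 -> (m0 <= m <= n)%N ->
  exists q, [/\ orthonormal_rows q m, (forall j, (j < m0)%N -> q j = q0 j) &
    forall j, (m0 <= j < m)%N -> vnorm (q j *m M) <= s (n - j.+1)%N].
Proof.
move=> gM oq0; elim: m => [|m IH] /andP[m0m mn].
  by exists q0; split => // j; rewrite ltn0 andbF.
move: m0m; rewrite leq_eqVlt => /predU1P[m0E|m0m].
  by exists q0; split; rewrite -?m0E // => j /andP[a b]; rewrite ltnNge a in b.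
have [|q [oq qq0 hq]] := IH; first by rewrite -ltnS m0m ltnW.
have [U hU] := gM (n - m.+1)%N.
pose V := \matrix_(i < m) q i.
pose X := (col_mx V U)^t*.
have : kermx X != 0.
  rewrite kermx_eq0 /row_free neq_ltn; apply/orP; left.
  apply: leq_ltn_trans (rank_leq_col _) _.
  by rewrite -addSn subnKC.
case/rowV0Pn => v0 /sub_kermxP; rewrite /X tr_col_mx map_row_mx mul_mx_row.
rewrite -[0]row_mx0 => /eq_row_mx[vV vU] v00.
pose v := ((vnorm v0)^-1)%:C *: v0.
have v1 : vnorm v = 1.
  rewrite vnormZ rnorm_real ger0_norm ?invr_ge0 ?vnorm_ge0 // mulVf //.
  by rewrite gt_eqF // vnorm_gt0.
have vq i : (i < m)%N -> dot v (q i) = 0.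
  move=> im; have /rowP/(_ (Ordinal im)) := vV; rewrite !mxE => h.
  rewrite dotE; under eq_bigr => k _ do rewrite mxE -mulrA.
  rewrite -mulr_sumr; apply/eqP; rewrite mulf_eq0; apply/orP; right; apply/eqP.
  by rewrite -[RHS]h; apply: eq_bigr => k _; rewrite !mxE.
have qv i : (i < m)%N -> dot (q i) v = 0.
  by move=> im; rewrite dotC vq // conjc0.
exists (set_at q m v); split.
- move=> i j; rewrite !ltnS leq_eqVlt => /predU1P[->|il];
    rewrite leq_eqVlt => /predU1P[->|jl]; rewrite ?set_atx ?set_atE //.
  + by rewrite dot_self v1 expr1n eqxx.
  + by rewrite vq // gtn_eqF.
  + by rewrite qv // ltn_eqF.
  + exact: oq.
- by move=> j jm0; rewrite set_atE ?qq0 // (leq_trans jm0).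
move=> j; rewrite ltnS => /andP[m0j]; rewrite leq_eqVlt => /predU1P[->|jm].
  rewrite set_atx -[X in _ <= X]mulr1 -v1; apply: hU.
  by rewrite -scalemxAl vU scaler0.
by rewrite set_atE // hq // m0j.
Qed.

Lemma det_le_rows n (M : 'M[C]_n) (q : nat -> 'rV[C]_n) : orthonormal_rows q n ->
  rnorm (\det M) <= \prod_(j < n) vnorm (q j *m M).
Proof.
move=> oq; pose Q := \matrix_(j < n) q j.
have QU : Q \is unitarymx.
  by apply/row_unitarymxP => i j; rewrite !rowK oq // val_eqE.
have := hadamard (Q *m M); rewrite det_mulmx rnormM (det_unitary QU) mul1r.
by under eq_bigr => i _ do rewrite row_mul rowK.
Qed.

Lemma det_1add_le n (M : 'M[C]_n) s : gelfand_mx M s ->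
  rnorm (\det (1%:M + M)) <= \prod_(k < n) (1 + s k).
Proof.
move=> gM.
have [||q [oq _ hq]] := adapted_basis (q0 := fun=> 0) (m0 := 0) (m := n) gM.
- by [].
- by rewrite leqnn.
apply: le_trans (det_le_rows _ oq) _.
(* The vector q_j comes with the bound s_(n-1-j), so the product is read backwards. *)
rewrite [X in _ <= X](reindex_inj rev_ord_inj) /=.
apply: ler_prod => j _; rewrite vnorm_ge0 /= mulmxDr mulmx1.
apply: le_trans (vnormD _ _) _; apply: lerD; last by apply: hq; rewrite ltn_ord.
rewrite -(@ler_pXn2r _ 2) ?nnegrE ?vnorm_ge0 // expr1n -lecR -dot_self.
by rewrite oq // eqxx.
Qed.

(** The basis starts with x / |x|, whose row contributes |x (1 + M)| / |x|; only the other rows are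
    estimated by 1 + s_k. *)
Lemma det_1add_le_vec n (M : 'M[C]_n) s (x : 'rV[C]_n) : gelfand_mx M s ->
  (forall k, 0 <= s k) ->
  rnorm (\det (1%:M + M)) * vnorm x <=
    vnorm (x *m (1%:M + M)) * \prod_(k < n) (1 + s k).
Proof.
move=> gM s0.
have s1 k : 1 <= 1 + s k by rewrite lerDl.
have P0 m : 0 <= \prod_(k < m) (1 + s k).
  by apply: prodr_ge0 => k _; rewrite addr_ge0.
have [->|x0] := eqVneq x 0.
  by rewrite vnorm0 mulr0 mulr_ge0 ?vnorm_ge0.
case: n => [|n] in M x gM x0 *; first by rewrite thinmx0 eqxx in x0.
have xp := vnorm_gt0 x0.
pose v := ((vnorm x)^-1)%:C *: x.
have v1 : vnorm v = 1.
  rewrite vnormZ rnorm_real ger0_norm ?invr_ge0 ?vnorm_ge0 // mulVf //.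
  by rewrite gt_eqF.
have [||q [oq q0 hq]] := adapted_basis (q0 := fun=> v) (m0 := 1) (m := n.+1) gM.
- by move=> [|//] [|//] _ _; rewrite dot_self v1 expr1n.
- by rewrite leqnn.
rewrite -ler_pdivlMr // mulrAC; apply: le_trans (det_le_rows _ oq) _.
rewrite big_ord_recl q0 // /v -scalemxAl vnormZ rnorm_real.
rewrite ger0_norm ?invr_ge0 ?vnorm_ge0 // [_^-1 * _]mulrC ler_wpM2l //.
  by rewrite mulr_ge0 ?invr_ge0 ?vnorm_ge0.
(* One row went to [x], so the n others use s_0, ..., s_(n-1); the last factor on the right is just
   bounded below by 1. *)
rewrite big_ord_recr /= -[X in X <= _]mulr1 ler_pM // ?ler01 //.
  by apply: prodr_ge0 => k _; apply: vnorm_ge0.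
rewrite [X in _ <= X](reindex_inj rev_ord_inj) /=.
apply: ler_prod => j _; rewrite vnorm_ge0 /= mulmxDr mulmx1.
apply: le_trans (vnormD _ _) _; apply: lerD; last first.
  have := hq (bump 0 j); rewrite /bump /= add1n subSS; apply.
  by rewrite ltnS /= ltn_ord.
rewrite -(@ler_pXn2r _ 2) ?nnegrE ?vnorm_ge0 // expr1n -lecR -dot_self.
by rewrite oq ?eqxx // /bump /= add1n ltnS ltn_ord.
Qed.

(** The value 1 at 0 keeps the diagonal matrix of phases unitary. *)
Definition phase (a : C) : C := if a == 0 then 1 else (rnorm a)%:C / a.

Lemma phaseM a : phase a * a = (rnorm a)%:C.
Proof.
rewrite /phase; have [->|a0] := eqVneq a 0; first by rewrite mulr0 rnorm0.
by rewrite divfK.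
Qed.

Lemma rnorm_phase a : rnorm (phase a) = 1.
Proof.
rewrite /phase; have [a0|a0] := eqVneq a 0; first exact: rnorm1.
rewrite rnormM rnormV rnorm_real ger0_norm ?rnorm_ge0 // divff //.
by rewrite rnorm_eq0.
Qed.

(* Multiplying the rows by phases turns the diagonal into its modulus without
   changing the Gelfand numbers. *)
Lemma prod_trig_le n (M : 'M[C]_n) s : is_trig_mx M -> gelfand_mx M s ->
  \prod_i (1 + rnorm (M i i)) <= \prod_(k < n) (1 + s k).
Proof.
move=> /is_trig_mxP Mt gM; pose D := diag_mx (\row_i phase (M i i)).
have DU : D \is unitarymx.
  apply/row_unitarymxP => i j; rewrite dotE.
  rewrite (bigD1 i) //= big1 => [|k ki].
    rewrite !mxE eqxx mulr1n addr0 eq_sym; have [->|ij] := eqVneq j i.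
      by rewrite mulr1n mulC_conj rnorm_phase expr1n.
    by rewrite mulr0n conjc0 mulr0.
  by rewrite !mxE eq_sym (negbTE ki) mulr0n mul0r.
have := det_1add_le (gelfand_unitary_l DU gM).
have tr : is_trig_mx (1%:M + D *m M).
  apply/is_trig_mxP => i j ij; rewrite mul_diag_mx !mxE (Mt i j ij) mulr0 addr0.
  by rewrite -val_eqE ltn_eqF.
rewrite det_trig // rnorm_prod; congr (_ <= _); apply: eq_bigr => i _.
rewrite mul_diag_mx !mxE eqxx phaseM -[1%:R]/((1 : R)%:C) -rmorphD rnorm_real.
by rewrite ger0_norm // addr_ge0 ?rnorm_ge0.
Qed.

Lemma det_trig_pencil n (M : 'M[C]_n) a b : is_trig_mx M ->
  \det (a%:M - b *: M) = \prod_i (a - b * M i i).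
Proof.
move=> /is_trig_mxP Mt; rewrite det_trig.
  by apply: eq_bigr => i _; rewrite !mxE eqxx mulr1n.
apply/is_trig_mxP => i j ij; rewrite !mxE (Mt i j ij) mulr0 subr0.
by rewrite (_ : _ == _ = false) // -val_eqE ltn_eqF.
Qed.

(** The mu_i are the diagonal of a Schur form. Unitary conjugation preserves the Gelfand bounds, so
    [prod_trig_le] applies to it. *)
Lemma schur_eigenvalues n (M : 'M[C]_n) s : gelfand_mx M s ->
  exists mu : 'I_n -> C, [/\
    forall a, \det (1%:M - a *: M) = \prod_i (1 - a * mu i),
    forall i, exists2 v : 'rV[C]_n, v != 0 & v *m M = mu i *: v &
    \prod_i (1 + rnorm (mu i)) <= \prod_(k < n) (1 + s k)].
Proof.
move=> gM; case: n => [|n] in M gM *.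
  exists (fun=> 0); split=> [a|[]//|]; last by rewrite !big_ord0.
  by rewrite det_mx00 big_ord0.
have [P PU] := Schur M (ltn0Sn n).
rewrite /similar_to /= conjymx // => Tt; set M' := P *m M *m P^t* in Tt.
have gM' : gelfand_mx M' s.
  apply: gelfand_unitary_r; first by rewrite trmxC_unitary.
  exact: gelfand_unitary_l.
have PP : P *m P^t* = 1%:M by apply/unitarymxP.
have PP' : P^t* *m P = 1%:M by apply: mulmx1C.
have det_conj (X : 'M[C]_n.+1) : \det (P *m X *m P^t*) = \det X.
  by rewrite !det_mulmx mulrAC -det_mulmx PP det1 mul1r.
have trigE a b : \det (a%:M - b *: M) = \prod_i (a - b * M' i i).
  rewrite -det_conj mulmxBr mulmxBl -scalemxAr -scalemxAl -/M'.
  by rewrite mul_mx_scalar -scalemxAl PP scalemx1 det_trig_pencil.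
exists (fun i => M' i i); split; last exact: prod_trig_le.
  by move=> a; exact: trigE.
move=> i; have : \det ((M' i i)%:M - 1 *: M) = 0.
  by rewrite trigE (bigD1 i) //= mul1r subrr mul0r.
move/eqP/det0P => [v v0 hv]; exists v => //.
apply/esym/eqP; rewrite -subr_eq0 -hv scale1r mulmxBr mul_mx_scalar.
by [].
Qed.

End MatrixBounds.

(** * Scalar estimates *)

Section ScalarEstimates.
Variable R : realType.
Implicit Types (w a : R[i]) (s : nat -> R).

Lemma rnorm_1sub_ge w : rnorm w <= 8^-1 ->
  expR (- complex.Re w - 2 * rnorm w ^+ 2) <= rnorm (1 - w).
Proof.
move=> w8; rewrite -(@ler_pXn2r _ 2) ?nnegrE ?rnorm_ge0 ?expR_ge0 //.
rewrite (rnormE2 (1 - w)) -expRM_natl.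
have -> : complex.Re (1 - w) ^+ 2 + complex.Im (1 - w) ^+ 2 =
    1 - 2 * complex.Re w + rnorm w ^+ 2.
  by rewrite rnormE2; case: (w) => x y /=; ring.
have := Re_le_rnorm w; have := rnorm_ge0 w.
move: w8; set b := rnorm w; set x := complex.Re w => b8 b0 xb.
have {xb} [xb1 xb2] : - b <= x /\ x <= b by move: xb; rewrite ler_norml => /andP[].
pose y := 2 * x + 4 * b ^+ 2.
(* As exp (- y) <= 1 / (1 + y), it suffices that (1 - 2 x + b^2) (1 + y) >= 1. The excess is at
   least b^2 - 6 b^3, which is nonnegative for b <= 1/8. *)
have -> : 2%:R * (- x - 2 * b ^+ 2) = - y by rewrite /y; ring.
have y1 : 0 < 1 + y by rewrite /y; nra.
rewrite expRN; apply: (@le_trans _ _ (1 + y)^-1).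
  by rewrite lef_pV2 ?posrE ?expR_gt0 // expR_ge1Dx.
rewrite -[X in X <= _]mul1r ler_pdivrMr // /y.
have b2 : 0 <= b ^+ 2 by rewrite sqr_ge0.
have : x ^+ 2 <= b ^+ 2 by nra.
have : x * b ^+ 2 <= b * b ^+ 2 by rewrite ler_wpM2r.
have : b * b ^+ 2 <= 8^-1 * b ^+ 2 by rewrite ler_wpM2r.
have : 0 <= b ^+ 2 * b ^+ 2 by rewrite mulr_ge0.
nra.
Qed.

Lemma prod_1sub_ge n (mu : 'I_n -> R[i]) a : (forall i, rnorm (a * mu i) <= 8^-1) ->
  expR (- complex.Re (a * \sum_i mu i) - 2 * \sum_i rnorm (a * mu i) ^+ 2) <=
  rnorm (\prod_i (1 - a * mu i)).
Proof.
elim: n mu => [|n IH] mu h; first by rewrite !big_ord0 !mulr0 /= oppr0 addr0 expR0 rnorm1.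
rewrite !big_ord_recr /= [X in _ <= X]rnormM mulrDr ReD.
have E (p q t u : R) : - (p + q) - 2 * (t + u) = (- p - 2 * t) + (- q - 2 * u) by ring.
rewrite E expRD ler_pM ?expR_ge0 //; last exact: rnorm_1sub_ge.
exact: IH.
Qed.

Lemma sum_le_prod n (x : 'I_n -> R) : (forall i, 0 <= x i) ->
  1 + \sum_i x i <= \prod_i (1 + x i).
Proof.
elim: n x => [|n IH] x x0; first by rewrite !big_ord0 addr0.
rewrite !big_ord_recr /=.
have := IH _ (fun i => x0 (widen_ord (leqnSn n) i)).
have := x0 ord_max.
have : 0 <= \sum_(i < n) x (widen_ord (leqnSn n) i) by exact: sumr_ge0.
set S := \sum_(i < n) _; set P := \prod_(i < n) _; set t := x _; nra.
Qed.

(* If [p a = \prod_i (1 - a * mu i)] grows at most like [exp (eta * r)] on the circle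
   of radius [r] while all its zeros are far away, then [\sum_i mu i] is small: at the
   point of the circle where [a * \sum_i mu i] is negative, [p] is of size
   [exp (r * `|\sum_i mu i|)]. *)
Lemma prod_1sub_near1 n (mu : 'I_n -> R[i]) (eta r rho F : R) :
  0 < r -> 0 <= eta -> 0 <= rho -> r * rho <= 8^-1 -> rho <= 8^-1 ->
  (forall i, rnorm (mu i) <= rho) -> \prod_i (1 + rnorm (mu i)) <= F ->
  (forall a, rnorm a = r -> rnorm (\prod_i (1 - a * mu i)) <= expR (eta * r)) ->
  expR (- (eta + 2 * r * rho * F + 2 * rho * F)) <= rnorm (\prod_i (1 - mu i)).
Proof.
move=> r0 eta0 rho0 rrho rho8 hmu hF hp.
have F1 : \sum_i rnorm (mu i) <= F.
  apply: le_trans hF; apply: le_trans (sum_le_prod _); rewrite ?lerDr ?ler01 //.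
  by move=> i; apply: rnorm_ge0.
have sq a : \sum_i rnorm (a * mu i) ^+ 2 <= rnorm a ^+ 2 * (rho * F).
  apply: (@le_trans _ _ (\sum_i rnorm a ^+ 2 * (rho * rnorm (mu i)))).
    apply: ler_sum => i _; rewrite rnormM exprMn ler_wpM2l ?sqr_ge0 // expr2.
    by rewrite ler_wpM2r ?rnorm_ge0.
  by rewrite -mulr_sumr ler_wpM2l ?sqr_ge0 // -mulr_sumr ler_wpM2l.
set tau := \sum_i mu i.
(* The term 2 r rho F comes from the quadratic remainder 2 r^2 rho F on the circle, divided by r;
   the same remainder at a = 1 gives the last 2 rho F of the exponent. *)
have tau_le : rnorm tau <= eta + 2 * r * rho * F.
  have F0 : 0 <= F by apply: le_trans F1; apply: sumr_ge0 => i _; apply: rnorm_ge0.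
  have [->|t0] := eqVneq tau 0.
    by rewrite rnorm0 addr_ge0 // !mulr_ge0 // ltW.
  have tp : 0 < rnorm tau by rewrite rnorm_gt0.
  pose a := (- (r / rnorm tau))%:C * (tau^*)%C.
  have ar : rnorm a = r.
    rewrite rnormM rnorm_conj rnorm_real normrN ger0_norm ?divfK ?gt_eqF //.
    by rewrite divr_ge0 // ltW.
  have atau : complex.Re (a * tau) = - (r * rnorm tau).
    rewrite -mulrA [_^*%C * _]mulrC mulC_conj -CrM /=.
    by rewrite expr2 mulNr mulrA divfK ?gt_eqF.
  have := le_trans (prod_1sub_ge (a := a) (mu := mu) _) (hp a ar).
  rewrite -/tau atau opprK ler_expR => h.
  have {h} : r * rnorm tau - 2 * \sum_i rnorm (a * mu i) ^+ 2 <= eta * r.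
    apply: h => i; rewrite rnormM ar; apply: le_trans rrho.
    by rewrite ler_wpM2l // ltW.
  have := sq a; rewrite ar => h1 h2.
  rewrite -(ler_pM2l r0); move: h1 h2; set q := \sum_i _; nra.
have := prod_1sub_ge (a := 1) (mu := mu) _.
have -> : \prod_i (1 - 1 * mu i) = \prod_i (1 - mu i).
  by apply: eq_bigr => i _; rewrite mul1r.
move=> h; apply: le_trans (h _); last first.
  by move=> i; rewrite mul1r; apply: le_trans rho8.
rewrite ler_expR -/tau mul1r.
have := sq 1; rewrite rnorm1 expr1n mul1r.
have := le_trans (ler_norm _) (Re_le_rnorm tau).
move: tau_le; set q := \sum_i _; lra.
Qed.

Lemma summable_tail s (S eta : R) : (forall k, 0 <= s k) ->
  (forall n, \sum_(k < n) s k <= S) -> 0 < eta ->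
  exists K, forall m, \sum_(k < m) (if (k < K)%N then 0 else s k) <= eta.
Proof.
move=> s0 hS e0.
pose E := [set \sum_(k < n) s k | n in [set: nat]].
have Es : has_sup E.
  by split; [exists (\sum_(k < 0) s k), 0%N | exists S => _ [n _ <-]].
have [_ [K _ <-] hK] := sup_adherent e0 Es.
exists K => m.
have up n : \sum_(k < n) s k <= sup E by apply: (ub_le_sup Es.2); exists n.
have [mK|Km] := leqP m K.
  rewrite big1 ?ltW // => i _; rewrite (leq_trans (ltn_ord i) mK) //.
have : \sum_(k < m) (if (k < K)%N then 0 else s k) + \sum_(k < K) s k <= \sum_(k < m) s k.
  rewrite (big_ord_widen m s (ltnW Km)) [X in _ + X]big_mkcond -big_split /=.
  by apply: ler_sum => i _; case: ifP; rewrite ?addr0 ?add0r.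
have := up m; lra.
Qed.

(** Finitely many factors grow only polynomially in r, and the tail of the sum is as small as
    desired in the exponent; so one large r serves all m. *)
Lemma prod_subexponential s (S eta : R) : (forall k, 0 <= s k) ->
  (forall n, \sum_(k < n) s k <= S) -> 0 < eta ->
  exists2 r, 0 < r & forall m, \prod_(k < m) (1 + r * s k) <= expR (eta * r).
Proof.
move=> s0 hS e0.
have e2 : 0 < eta / 2 by rewrite divr_gt0.
have [K hK] := summable_tail s0 hS e2.
have S0 : 0 <= S by apply: le_trans (hS 0%N); rewrite big_ord0.
have sS k : s k <= S.
  by apply: le_trans (hS k.+1); rewrite big_ord_recr /= lerDr sumr_ge0.
(* The first K factors may cost exp (c r) each, at most exp (eta r / 2) together. Since 4 S <= r
   c^2, 1 + r s_k <= (1 + c r / 2)^2 <= exp (c r); the final 1 in [r] keeps it positive when S =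
   0. *)
pose c : R := eta / (2 * K.+1%:R).
have c0 : 0 < c by rewrite divr_gt0 // mulr_gt0.
pose r := 4 * S / c ^+ 2 + 1.
have r0 : 0 < r.
  by rewrite ltr_wpDl //; apply: divr_ge0; [apply: mulr_ge0 | apply: sqr_ge0].
have rc : 4 * S <= r * c ^+ 2.
  by rewrite -ler_pdivrMr ?exprn_gt0 // lerDl.
exists r => // m.
pose t (k : nat) := if (k < K)%N then c * r else r * s k.
have step k : 1 + r * s k <= expR (t k).
  rewrite /t; case: ifP => _; last exact: expR_ge1Dx.
  apply: (@le_trans _ _ ((1 + c * r / 2) ^+ 2)).
    have := sS k; have := s0 k; have : 0 < c * r by rewrite mulr_gt0.
    move=> h1 h2 h3.
    have : 4 * (r * s k) <= (c * r) ^+ 2 by nra.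
    nra.
  rewrite [c * r in X in _ <= X](splitr (c * r)) expRD -expr2.
  rewrite ler_pXn2r ?nnegrE ?expR_ge0 ?expR_ge1Dx // addr_ge0 // ltW // divr_gt0 //.
  exact: mulr_gt0.
apply: (@le_trans _ _ (\prod_(k < m) expR (t k))).
  by apply: ler_prod => k _; rewrite step andbT addr_ge0 // mulr_ge0 // ltW.
rewrite -expR_sum ler_expR.
apply: (@le_trans _ _ (\sum_(k < m) ((if (k < K)%N then c * r else 0) +
    r * (if (k < K)%N then 0 else s k)))).
  by apply: ler_sum => k _; rewrite /t; case: ifP; rewrite ?mulr0 ?addr0 ?add0r.
rewrite big_split /= -mulr_sumr (splitr eta) [(_ / 2 + _) * r]mulrDl lerD //; last first.
  by rewrite mulrC; apply: ler_wpM2r; [exact: ltW | exact: hK].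
apply: (@le_trans _ _ (\sum_(k < K) (c * r))).
  rewrite -big_mkcond /=.
  have [mK|Km] := leqP m K; last first.
    by rewrite (big_ord_widen m (fun=> c * r) (ltnW Km)).
  rewrite (eq_bigl xpredT) => [|i]; last by rewrite (leq_trans (ltn_ord i) mK).
  rewrite !sumr_const !card_ord -![(c * r) *+ _]mulr_natl ler_wpM2r ?ler_nat //.
  by rewrite ltW // mulr_gt0.
rewrite sumr_const card_ord -[_ *+ K]mulr_natl mulrA ler_wpM2r ?(ltW r0) //.
have K1 : K.+1%:R != 0 :> R by rewrite pnatr_eq0.
have -> : K%:R * c = eta / 2 * (K%:R / K.+1%:R) by rewrite /c; field.
by rewrite ger_pMr // ler_pdivrMr ?ltr0n // mul1r ler_nat.
Qed.

End ScalarEstimates.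

(** * Finite sections *)

Section FiniteSections.
Variables (R : realType) (H : hilbertType R) (T : {linear H -> H}).
Local Open Scope sesquilinear_scope.
Implicit Types (x y z g : H) (a b w mu : R[i]) (e f us : nat -> H)
  (lam : nat -> R[i]) (s : nat -> R).

Definition gelfand s : Prop := forall k, exists us, forall x,
  (forall i, (i < k)%N -> '[x, us i] = 0) -> rnorm (T x) <= s k * rnorm x.

Definition comb f n (v : 'rV[R[i]]_n) : H := \sum_(i < n) v 0 i *: f i.

(** Row i holds the image of f_i, so coordinates are row vectors multiplied on the left and flags
    give lower triangular matrices. *)
Definition section_mx f n : 'M[R[i]]_n := \matrix_(i, j) '[T (f i), f j].

Lemma comb_is_linear f n : linear (@comb f n).
Proof.
move=> a u v; rewrite /comb scaler_sumr -big_split; apply: eq_bigr => i _ /=.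
by rewrite !mxE scalerDl scalerA.
Qed.
HB.instance Definition _ f n := GRing.isLinear.Build R[i] 'rV[R[i]]_n H *:%R
  (@comb f n) (@comb_is_linear f n).

Lemma rnorm_comb f n v : orthonormal_upto f n -> rnorm (@comb f n v) = vnorm v.
Proof.
move=> of_; apply/eqP; rewrite -(@eqrXn2 _ 2) ?rnorm_ge0 ?vnorm_ge0 //.
by rewrite (rnorm_comb2 (fun i => v 0 i) of_) vnorm_sqr.
Qed.

Lemma comb_coords f n x : comb f (\row_(j < n) '[x, f j]) = oproj f n x.
Proof. by apply: eq_bigr => i _; rewrite mxE. Qed.

Lemma comb_section f n (v : 'rV_n) :
  comb f (v *m section_mx f n) = oproj f n (T (comb f v)).
Proof.
rewrite -comb_coords; congr (comb f _); apply/rowP => j; rewrite !mxE.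
by rewrite op_sum ip_suml; apply: eq_bigr => i _; rewrite !mxE opZ ipZl.
Qed.

Lemma section_gelfand f n s : orthonormal_upto f n -> gelfand s ->
  gelfand_mx (section_mx f n) s.
Proof.
move=> of_ gT k; have [us hus] := gT k.
exists (\matrix_(i < k, j < n) '[us i, f j]) => v vU.
rewrite -!(rnorm_comb _ of_) comb_section.
apply: le_trans (rnorm_oproj _ of_) (hus _ _) => i ik.
have /rowP/(_ (Ordinal ik)) := vU; rewrite !mxE => h.
rewrite -[RHS]h ip_suml; apply: eq_bigr => j _.
by rewrite !mxE ipZl ipC.
Qed.

Lemma flag_section lam e n : flag T lam e n ->
  is_trig_mx (section_mx e n) /\ forall i, section_mx e n i i = lam i.
Proof.
move=> fl; have he i j : (i < n)%N -> (j < n)%N -> '[T (e i), e j] =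
    lam i * (i == j)%:R + '[shift_op T (lam i) (e i), e j].
  move=> il jl; rewrite -(fl.1 i j il jl) -ipZl -ipDl.
  by rewrite /shift_op addrC subrK.
have h0 i j : (i < n)%N -> (j < n)%N -> (i <= j)%N ->
    '[shift_op T (lam i) (e i), e j] = 0.
  move=> il jl ij; rewrite -(fl.2 i il) ip_suml big1 // => k _.
  by rewrite ipZl fl.1 ?(ltn_trans (ltn_ord k)) // ltn_eqF ?mulr0 // (leq_trans (ltn_ord k)).
split=> [|i]; last by rewrite mxE he // h0 // eqxx mulr1 addr0.
apply/is_trig_mxP => i j ij; rewrite mxE he // h0 //; last exact: ltnW.
by rewrite ltn_eqF // mulr0 addr0.
Qed.

(** A Weyl inequality: it transfers the bound on the singular values to the eigenvalues. *)
Lemma flag_prod_le lam e n s : flag T lam e n -> gelfand s ->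
  \prod_(i < n) (1 + rnorm (lam i)) <= \prod_(k < n) (1 + s k).
Proof.
move=> fl gT; have [Mt Md] := flag_section fl.
apply: le_trans (prod_trig_le Mt (section_gelfand fl.1 gT)).
by apply: ler_prod => i _; rewrite Md lexx andbT addr_ge0 ?rnorm_ge0.
Qed.

Lemma enumeration_small lam s (F rho : R) : eigenvalue_enumeration T lam ->
  gelfand s -> (forall n, \prod_(k < n) (1 + s k) <= F) -> 0 < rho ->
  exists n0, forall n, (n0 <= n)%N -> rnorm (lam n) < rho.
Proof.
move=> en gT hF rho0.
suff [n0 h0] : exists n, rnorm (lam n) < rho.
  exists n0 => n nn; apply: le_lt_trans h0.
  rewrite -(subnK nn); elim: (n - n0)%N => [//|d IH].
  by rewrite addSn; apply: le_trans (en.1 _) IH.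
apply: contrapT => no.
have big n : rho <= rnorm (lam n).
  by rewrite leNgt; apply/negP => h; apply: no; exists n.
pose n := Num.truncn (F / rho).
have [|e fl] := enumeration_flag (n := n.+1) en.
  by move=> k _; rewrite -rnorm_gt0; apply: lt_le_trans (big k).
have := le_trans (flag_prod_le fl gT) (hF _); apply/negP; rewrite -ltNge.
apply: lt_le_trans (sum_le_prod (fun i => rnorm_ge0 (lam (i : 'I_n.+1)))).
rewrite ltr_wpDl //; apply: (@lt_le_trans _ _ (\sum_(i < n.+1) rho)).
  by rewrite sumr_const card_ord -mulr_natl -ltr_pdivrMr // truncnS_gt.
by apply: ler_sum.
Qed.

Lemma oproj_split f n m x :
  oproj f (n + m) x = oproj f n x + oproj (fun i => f (n + i)%N) m x.
Proof. by rewrite /oproj big_split_ord. Qed.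

(** The span of the first n vectors is invariant, so the upper right block vanishes and the upper
    left one is triangular. *)
Lemma det_section lam f n m : orthonormal_upto f (n + m) -> flag T lam f n ->
  \det (1%:M - section_mx f (n + m)) =
  \prod_(k < n) (1 - lam k) * \det (1%:M - section_mx (fun i => f (n + i)%N) m).
Proof.
move=> of_ fl; set M := section_mx f (n + m).
have Mul : ulsubmx M = section_mx f n by apply/matrixP => i j; rewrite !mxE.
have Mdr : drsubmx M = section_mx (fun i => f (n + i)%N) m.
  by apply/matrixP => i j; rewrite !mxE.
have Mur : ursubmx M = 0.
  apply/matrixP => i j; rewrite !mxE /= -(flag_op_e fl (ltn_ord i)).
  rewrite ip_suml big1 // => k _; rewrite ipZl of_ ?ltn_add2l //.
    by rewrite ltn_eqF ?mulr0 // (leq_trans (ltn_ord k)) // leq_addr.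
  by rewrite (leq_trans (ltn_ord k)) // leq_addr.
rewrite -(submxK M) Mul Mur Mdr scalar_mx_block.
rewrite opp_block_mx add_block_mx oppr0 addr0 det_lblock; congr (_ * _).
have [Mt Md] := flag_section fl.
rewrite -[section_mx f n]scale1r det_trig_pencil //.
by apply: eq_bigr => i _; rewrite mul1r Md.
Qed.

Lemma det_section_le_vec f n s x : orthonormal_upto f n -> gelfand s ->
  (forall k, 0 <= s k) -> oproj f n x = x ->
  rnorm (\det (1%:M - section_mx f n)) * rnorm x <=
    rnorm (x - T x) * \prod_(k < n) (1 + s k).
Proof.
move=> of_ gT s0 xE.
have gM : gelfand_mx (- section_mx f n) s.
  move=> k; have [U hU] := section_gelfand of_ gT k; exists U => v /hU.
  by rewrite mulmxN -scaleN1r vnormZ rnormN rnorm1 mul1r.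
pose c := \row_(j < n) '[x, f j].
have cx : comb f c = x by rewrite comb_coords.
have := det_1add_le_vec c gM s0; rewrite -!(rnorm_comb _ of_) cx => /le_trans; apply.
apply: ler_wpM2r; first by apply: prodr_ge0 => k _; rewrite addr_ge0.
rewrite mulmxDr mulmx1 mulmxN linearB /= comb_section cx -{1}xE -linearB.
exact: rnorm_oproj.
Qed.

Lemma section_circle f n s (r B : R) a : orthonormal_upto f n -> gelfand s ->
  rnorm a = r -> \prod_(k < n) (1 + r * s k) <= B ->
  rnorm (\det (1%:M - a *: section_mx f n)) <= B.
Proof.
move=> of_ gT ar; apply: le_trans.
rewrite -scaleNr -ar -(rnormN a); apply: (@det_1add_le _ _ _ (fun k => rnorm (- a) * s k)).
exact/gelfand_scale/section_gelfand.
Qed.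

Lemma summable_small s (S eta : R) : (forall k, 0 <= s k) ->
  (forall n, \sum_(k < n) s k <= S) -> 0 < eta -> exists K, s K <= eta.
Proof.
move=> s0 hS e0; have [K hK] := summable_tail s0 hS e0; exists K.
apply: le_trans (hK K.+1); rewrite big_ord_recr /= ltnn lerDr sumr_ge0 // => i _.
by case: ifP.
Qed.

(** Off K suitable vectors T has norm at most s_K <= delta. Putting the T-images of an orthonormal
    basis of their span into the section leaves only this small part outside. *)
Lemma exists_section e n s (delta : R) x (S : R) : orthonormal_upto e n ->
  gelfand s -> (forall k, 0 <= s k) -> (forall n, \sum_(k < n) s k <= S) ->
  0 < delta ->
  exists f m, [/\ orthonormal_upto f (n + m),
    forall i, (i < n)%N -> f i = e i, oproj f (n + m) x = x &
    forall y, rnorm (T y - oproj f (n + m) (T y)) <= delta * rnorm y].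
Proof.
move=> oe gT s0 hS d0; have [K sK] := summable_small s0 hS d0.
have [us hus] := gT K.
have o0 : orthonormal_upto us 0 by [].
have [g [m' [_ og _ hg]]] := gram_schmidt (map us (iota 0 K)) o0.
have [f [N [nN of_ fe fs]]] :=
  gram_schmidt (x :: map (fun i => T (g i)) (iota 0 m')) oe.
have NE : N = (n + (N - n))%N by rewrite subnKC.
exists f, (N - n)%N; rewrite -NE; split=> // [|y]; first by rewrite fs ?mem_head.
pose y' := y - oproj g m' y.
have yE : T y = T y' + T (oproj g m' y) by rewrite -opD subrK.
have pT : oproj f N (T (oproj g m' y)) = T (oproj g m' y).
  have -> : T (oproj g m' y) = \sum_(i < m') '[y, g i] *: T (g i).
    by rewrite op_sum; apply: eq_bigr => i _; rewrite opZ.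
  rewrite linear_sum; apply: eq_bigr => i _; rewrite linearZ /= fs // in_cons; apply/orP; right.
  by apply/mapP; exists (i : nat); rewrite ?mem_iota /=.
rewrite yE [oproj f N (_ + _)]linearD /= pT opprD addrACA subrr addr0.
apply: le_trans (rnorm_oproj_compl _ of_) _.
apply: (@le_trans _ _ (s K * rnorm y')).
  apply: hus => i iK; rewrite -(hg (us i)); last first.
    by apply/mapP; exists i; rewrite ?mem_iota.
  by rewrite -ip_oproj oproj_compl // ip0l.
by rewrite ler_pM ?rnorm_ge0 //; apply: rnorm_oproj_compl.
Qed.

(** The contrapositive of [eigenvector_of_approximate]: compactness gives one gap for the whole disc
    of scalars. *)
Lemma no_eigenvector_gap (Q : {linear H -> H}) (r : R) :
  cluster_compact Q -> 0 <= r ->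
  (forall y a, y != 0 -> rnorm a <= r -> y != a *: Q y) ->
  exists2 eps : R, 0 < eps & forall y a, y != 0 -> rnorm a <= r ->
    eps * rnorm y < rnorm (y - a *: Q y).
Proof.
move=> cQ r0 no; apply: contrapT => nogap.
have [eps e0|y [a [y0 ar ya]]] := eigenvector_of_approximate cQ r0; last first.
  by have := no y a y0 ar; rewrite -ya eqxx.
apply: contrapT => nex; apply: nogap; exists eps => // y a y0 ar.
rewrite ltNge; apply/negP => h; apply: nex; exists (normalize y), a; split.
- exact: rnorm_normalize.
- by apply: le_trans ar _; rewrite lerDl ltW.
rewrite /normalize opZ scalerA mulrC -scalerA -scalerBr rnormZ rnorm_real.
rewrite ger0_norm ?invr_ge0 ?rnorm_ge0 // mulrC ler_pdivrMr //.
by rewrite rnorm_gt0.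
Qed.

(** An eigenvector y of the section satisfies Q y = mu y + (error of size delta |y|), with Q the
    compression of T. If |mu| > rho, then a = 1 / mu makes |y - a Q y| at most eps |y|, against the
    gap. *)
Lemma section_eigenvalue_le e f n m (eps rho delta : R) mu (v : 'rV[R[i]]_m) :
  orthonormal_upto f (n + m) -> (forall i, (i < n)%N -> f i = e i) ->
  0 < rho -> 0 < eps -> delta <= rho * eps ->
  (forall y a, y != 0 -> rnorm a <= rho^-1 ->
     eps * rnorm y < rnorm (y - a *: compression T e n y)) ->
  (forall y, rnorm (T y - oproj f (n + m) (T y)) <= delta * rnorm y) ->
  v != 0 -> v *m section_mx (fun i => f (n + i)%N) m = mu *: v ->
  rnorm mu <= rho.
Proof.
move=> of_ fe rho0 e0 drho gap hP v0 hv; rewrite leNgt; apply/negP => mub.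
pose f' i := f (n + i)%N.
have of' : orthonormal_upto f' m.
  by move=> i j im jm; rewrite of_ ?ltn_add2l // eqn_add2l.
set y := comb f' v.
have y0 : y != 0 by rewrite -rnorm_gt0 rnorm_comb // vnorm_gt0.
have yW : oproj e n y = 0.
  rewrite /oproj big1 // => i _; rewrite -fe // ip_suml big1 ?scale0r // => j _.
  rewrite ipZl of_ ?ltn_add2l ?(leq_trans (ltn_ord i)) ?leq_addr //.
  by rewrite gtn_eqF ?mulr0 // (leq_trans (ltn_ord i)) ?leq_addr.
have mu0 : mu != 0 by rewrite -rnorm_gt0 (lt_trans rho0).
have Qy : compression T e n y = mu *: y + (T y - oproj f (n + m) (T y)).
  have hy : oproj f' m (T y) = mu *: y by rewrite -comb_section hv linearZ.
  rewrite /compression /= (ocompl_fix yW) oproj_split -/f' hy /ocompl.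
  by rewrite (eq_oproj _ fe) opprD (addrA (T y)) [RHS]addrC subrK.
have := gap y mu^-1 y0; rewrite Qy scalerDr scalerA mulVf // scale1r opprD addrA subrr add0r.
rewrite rnormN rnormZ rnormV lef_pV2 ?posrE // ?(lt_trans rho0) // => /(_ (ltW mub)).
apply/negP; rewrite -leNgt ler_pdivrMl ?(lt_trans rho0) //.
apply: le_trans (hP y) _; rewrite mulrA ler_wpM2r ?rnorm_ge0 //.
apply: le_trans drho _; by rewrite ler_pM2r // ltW.
Qed.

(** The order of choices matters: the radius r from eps, then rho from r, then n from rho, then the
    gap from n, and last the section from the gap and x. *)
Lemma determinant_estimate lam s (S F eps : R) x :
  cluster_compact T -> gelfand s -> (forall k, 0 <= s k) ->
  (forall n, \sum_(k < n) s k <= S) ->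
  (forall n, \prod_(k < n) (1 + s k) <= F) ->
  eigenvalue_enumeration T lam -> 0 < eps ->
  exists n0, forall n, (n0 <= n)%N ->
    expR (- eps) * (rnorm (\prod_(k < n) (1 - lam k)) * rnorm x) <=
      rnorm (x - T x) * F.
Proof.
move=> cT gT s0 hS hF en e0.
have e2 : 0 < eps / 2 by rewrite divr_gt0.
have F1 : 1 <= F by apply: le_trans (hF 0%N); rewrite big_ord0.
have F0 : 0 < F by apply: lt_le_trans F1.
have [r r0 hr] := prod_subexponential s0 hS e2.
(* [c] is the coefficient of rho in the exponent of [prod_1sub_near1]; with eta = eps / 2, the third
   term of the minimum keeps the exponent below eps. *)
pose c := 2 * r * F + 2 * F.
have c0 : 0 < c by rewrite addr_gt0 // !mulr_gt0.
pose rho := Num.min 8^-1 (Num.min ((8 * r)^-1) (eps / 2 / c)).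
have rho0 : 0 < rho.
  have r8 : 0 < 8 * r by rewrite mulr_gt0.
  by rewrite !lt_min !invr_gt0 ltr0n r8 divr_gt0.
have rho1 : rho <= 8^-1 by rewrite ge_min lexx.
have rho2 : r * rho <= 8^-1.
  by rewrite -ler_pdivlMl // mulrC -invfM /rho !ge_min lexx !orbT.
have rho3 : rho * c <= eps / 2.
  by rewrite -ler_pdivlMr // /rho !ge_min lexx !orbT.
have [n0 hn0] := enumeration_small en gT hF rho0.
exists n0 => N nN.
have [n [_ l0 ln <-]] := nonzero_prefix N en.1.
have lam_rho : rnorm (lam n) < rho by rewrite ln hn0.
have [e fl] := enumeration_flag en l0.
have cQ := compression_compact fl.1 cT.
have [||gap gap0 hgap] := no_eigenvector_gap (r := rho^-1) cQ.
- by rewrite invr_ge0 ltW.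
- move=> y a y0 ar; apply/eqP => ya.
  have a0 : a != 0 by apply: contraNneq y0 => a0; rewrite ya a0 scale0r.
  have ai0 : a^-1 != 0 by rewrite invr_eq0.
  have q : quotient_eigenpair T e n a^-1 y.
    apply/quotient_eigenpairP => //; first exact: fl.1.
    by split=> //; rewrite {2}ya scalerA mulVf // scale1r.
  have := le_lt_trans (enumeration_quotient_le en fl ai0 q) lam_rho.
  rewrite rnormV; apply/negP; rewrite -leNgt -[rho]invrK lef_pV2 ?posrE ?invr_gt0 //.
  by rewrite rnorm_gt0.
have d0 : 0 < rho * gap by rewrite mulr_gt0.
have [f [m [of_ fe xE hP]]] := exists_section x fl.1 gT s0 hS d0.
pose f' i := f (n + i)%N.
have of' : orthonormal_upto f' m.
  by move=> i j im jm; rewrite of_ ?ltn_add2l // eqn_add2l.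
have flf : flag T lam f n by apply: eq_flag fl => // i il; rewrite fe.
have [mu [hdet hev hmu]] := schur_eigenvalues (section_gelfand of' gT).
have hmur i : rnorm (mu i) <= rho.
  have [v v0 hv] := hev i.
  exact: (section_eigenvalue_le of_ fe rho0 gap0 (lexx _) hgap hP v0 hv).
have low := prod_1sub_near1 r0 (ltW e2) (ltW rho0) rho2 rho1 hmur
  (le_trans hmu (hF m)) _.
have {low} : expR (- eps) <= rnorm (\prod_i (1 - mu i)).
  apply: le_trans (low _).
    rewrite ler_expR lerN2 -addrA -[X in _ <= X](subrK (eps / 2)) addrC.
    rewrite lerD2r; apply: le_trans (_ : rho * c <= _); first by rewrite /c; lra.
    apply: le_trans rho3 _; lra.
  by move=> a ar; rewrite -hdet (section_circle of' gT ar).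
have := det_section_le_vec of_ gT s0 xE.
rewrite (det_section of_ flf) rnormM -/f'.
have -> : \det (1%:M - section_mx f' m) = \prod_i (1 - mu i).
  have := hdet 1; rewrite scale1r => ->; apply: eq_bigr => i _; by rewrite mul1r.
move=> up low; apply: (@le_trans _ _ (rnorm (x - T x) * \prod_(k < n + m) (1 + s k))).
  apply: le_trans up; rewrite mulrA ler_wpM2r ?rnorm_ge0 //.
  by rewrite mulrC ler_wpM2l ?rnorm_ge0.
by rewrite ler_wpM2l ?rnorm_ge0.
Qed.

End FiniteSections.

(** * The spectrum of a trace class operator *)

Section Spectrum.
Variables (R : realType) (H : hilbertType R).
Implicit Types (A K S T : {linear H -> H}) (x y z : H) (w : R[i]).

Lemma neumann_solution K y : (forall x, rnorm (K x) <= 2^-1 * rnorm x) ->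
  exists x, x - K x = y.
Proof.
move=> hK; pose u n := iter n (fun x => y + K x) 0.
have uS n : u n.+1 = y + K (u n) by [].
have ub n : rnorm (u n) <= 2 * rnorm y.
  elim: n => [|n IH]; first by rewrite rnorm0 mulr_ge0 ?rnorm_ge0.
  rewrite uS; apply: le_trans (rnormD _ _) _; have := hK (u n); lra.
have ud N k : rnorm (u (N + k)%N - u N) <= 2 * rnorm y * 2^-1 ^+ N.
  elim: N => [|N IH]; first by rewrite subr0 mulr1.
  rewrite addSn !uS opprD addrACA subrr add0r -opB.
  apply: le_trans (hK _) _; rewrite exprS mulrCA ler_wpM2l //.
have pow2 N : (2^-1 : R) ^+ N <= N.+1%:R^-1.
  rewrite exprVn lef_pV2 ?posrE ?exprn_gt0 ?ltr0n // -natrX ler_nat.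
  exact: ltn_expl.
have [l ul] : exists l : H, tends u l.
  apply: hilbert_complete => eps e0.
  have c0 : 0 < 2 * rnorm y + 1 by have := rnorm_ge0 y; lra.
  have [N /(_ N (leqnn N)) hN] := small_inv (divr_gt0 e0 c0).
  exists N => n Nn; rewrite -(subnKC Nn); apply: le_lt_trans (ud _ _) _.
  rewrite ltr_pdivlMr // in hN; apply: le_lt_trans hN; rewrite mulrC.
  by rewrite ler_pM ?exprn_ge0 ?mulr_ge0 ?rnorm_ge0 ?pow2 ?lerDl.
exists l; apply/eqP; rewrite -subr_eq0 -rnorm_eq0 eq_le rnorm_ge0 andbT.
apply/ler_addgt0Pr => eps e0; rewrite add0r.
have [N hN] := ul _ (divr_gt0 e0 (ltr0Sn R 1)).
have h1 := hN _ (leqnn N); have h2 := hN _ (leqnSn N).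
have -> : l - K l - y = (l - u N.+1) + K (u N - l).
  rewrite uS opB opprD -!addrA; congr (_ + _).
  by rewrite addKr addrC.
apply: le_trans (rnormD _ _) _; have := hK (u N - l); rewrite rnormB in h2.
lra.
Qed.

(** This makes d(z, sigma(A)) positive. With S = (w - A)^-1, the equation (v - A) x = y becomes x -
    (w - v) S x = S y, a Neumann problem. *)
Lemma resolvent_open A w : resolvent_set A w ->
  exists2 d : R, 0 < d & forall v, rnorm (w - v) < d -> resolvent_set A v.
Proof.
move=> [S [M0 hM0] [SA AS]].
pose M := `|M0| + 1; have M1 : 0 < M by rewrite ltr_wpDl.
have hM x : rnorm (S x) <= M * rnorm x.
  apply: le_trans (hM0 x) _; rewrite ler_wpM2r ?rnorm_ge0 //.
  by apply: le_trans (ler_norm _) _; rewrite lerDl.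
exists (2 * M)^-1; first by rewrite invr_gt0 mulr_gt0.
move=> v hv; pose k x := (w - v) *: S x.
have k_lin : linear k.
  by move=> a x y; rewrite /k opD opZ scalerDr !scalerA mulrC.
pose K : {linear H -> H} := HB.pack k (GRing.isLinear.Build R[i] H H *:%R k k_lin).
have hK x : rnorm (K x) <= 2^-1 * rnorm x.
  rewrite /= /k rnormZ.
  have h : rnorm (w - v) * M <= 2^-1.
    by rewrite -ler_pdivlMr // -invfM mulrC; move/ltW: hv; rewrite mulrC.
  apply: le_trans (ler_wpM2l (rnorm_ge0 _) (hM x)) _.
  by rewrite mulrA ler_wpM2r ?rnorm_ge0.
(* Injectivity of 1 - K gives both the linearity of the solution map and the left inverse
   identity. *)
have inj x y : x - K x = y - K y -> x = y.
  move=> e; have : (x - y) = K (x - y).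
    by apply/eqP; rewrite -subr_eq0 opB opprD addrACA -opprD e subrr.
  move=> xy; have := hK (x - y); rewrite -xy => h; apply/eqP; rewrite -subr_eq0 -rnorm_eq0.
  have := rnorm_ge0 (x - y); rewrite eq_le => ->; rewrite andbT; lra.
have [G hG] := choice (fun y => neumann_solution (S y) hK).
have G_lin : linear G.
  move=> a x y; apply: inj; rewrite hG opD opZ !(opD K) !(opZ K).
  by rewrite opprD addrACA -scalerBr !hG.
pose G' : {linear H -> H} := HB.pack G (GRing.isLinear.Build R[i] H H *:%R G G_lin).
exists G'.
  exists (2 * M) => y; have := rnorm_sub (G y) (K (G y)); rewrite hG.
  have := hM y; have := hK (G y); rewrite /=; lra.
have vw x : v *: x - A x = (w *: x - A x) - (w - v) *: x.
  by rewrite scalerBl opprB [RHS]addrC addrA subrK.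
split=> x.
  apply: inj; rewrite hG vw opB opZ SA //.
have E : G x = S (x + (w - v) *: G x).
  by rewrite opD opZ -[LHS](subrK (K (G x))) hG.
by rewrite /= vw {1 2}E AS addrK.
Qed.

Lemma has_dim_of_orthonormal e n : orthonormal_upto e n ->
  (forall x, oproj e n x = x) -> has_dim [set: H] n.
Proof.
move=> oe hx; exists (fun i : 'I_n => e i); split.
  by move=> c hc i; rewrite -(ip_comb c i oe) hc ip0l.
apply/seteqP; split=> // x _; exists (fun i : 'I_n => '[x, e i]).
exact/esym/hx.
Qed.

(** A bounded inverse would give |y| <= M |A y| <= M s_k |y| on the complement of k vectors, which
    is non-zero in infinite dimension, while s_k is arbitrarily small. *)
Lemma zero_in_spectrum A (s : nat -> R) : infinite_dimensional H ->
  gelfand A s -> (forall d : R, 0 < d -> exists k, s k <= d) -> spectrum A 0.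
Proof.
move=> hinf gA s_small [S [M0 hM0] [SA _]].
pose M := `|M0| + 1; have M1 : 0 < M by rewrite ltr_wpDl.
have hM x : rnorm (S x) <= M * rnorm x.
  apply: le_trans (hM0 x) _; rewrite ler_wpM2r ?rnorm_ge0 //.
  by apply: le_trans (ler_norm _) _; rewrite lerDl.
have [|k sk] := s_small (2 * M)^-1; first by rewrite invr_gt0 mulr_gt0.
have [us hus] := gA k.
have o0 : orthonormal_upto us 0 by [].
have [g [m [_ og _ hg]]] := gram_schmidt (map us (iota 0 k)) o0.
have [x xW] : exists x, oproj g m x <> x.
  apply/existsNP => all; apply: hinf; exists m; exact: has_dim_of_orthonormal og all.
pose y := x - oproj g m x.
have y0 : 0 < rnorm y by rewrite rnorm_gt0 subr_eq0 eq_sym; apply/eqP.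
have Ay : rnorm (A y) <= s k * rnorm y.
  apply: hus => i ik; rewrite -(hg (us i)); last first.
    by apply/mapP; exists i; rewrite ?mem_iota.
  by rewrite -ip_oproj oproj_compl // ip0l.
have := hM (0 *: y - A y); rewrite SA scale0r add0r rnormN => h.
have h2 : M * rnorm (A y) <= 2^-1 * rnorm y.
  apply: (@le_trans _ _ (M * ((2 * M)^-1 * rnorm y))).
    rewrite ler_wpM2l ?(ltW M1) //; apply: le_trans Ay _.
    by rewrite ler_wpM2r ?rnorm_ge0.
  by rewrite mulrA invfM mulrCA mulfV ?gt_eqF // mulr1.
lra.
Qed.

(** Boundedness of both operators makes the supremum in [opnorm] a genuine upper bound. *)
Lemma le_opnorm A T x : bounded_operator A -> bounded_operator T ->
  rnorm (A x - T x) <= opnorm (fun x => A x - T x) * rnorm x.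
Proof.
move=> [M hM] [N hN]; pose E := [set rnorm (A x - T x) | x in [set x | rnorm x <= 1]].
have Eb : has_ubound E.
  exists (`|M| + `|N|) => _ [y /= y1 <-]; apply: le_trans (rnorm_triB _ _) _.
  apply: lerD; [apply: le_trans (hM y) _ | apply: le_trans (hN y) _];
    (apply: le_trans (ler_wpM2r (rnorm_ge0 y) (ler_norm _)) _);
    by rewrite ler_piMr.
have [->|x0] := eqVneq x 0; first by rewrite (op0 A) (op0 T) subr0 !rnorm0 mulr0.
have -> : A x - T x = (rnorm x)%:C *: (A (normalize x) - T (normalize x)).
  by rewrite scalerBr -(opZ A) -(opZ T) -normalizeK.
rewrite rnormZ rnorm_real ger0_norm ?rnorm_ge0 // mulrC ler_wpM2r ?rnorm_ge0 //.
by apply: ub_le_sup => //; exists (normalize x); rewrite //= rnorm_normalize.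
Qed.

End Spectrum.

(** * Trace class operators and passage to the limit *)

Section TraceClass.
Variables (R : realType) (H : hilbertType R) (A : {linear H -> H}).
Hypothesis hA : trace_class A.
Local Notation s := (singular_value A).

Lemma trace_class_cluster_compact : cluster_compact A.
Proof. exact: compact_operator_cluster hA.1. Qed.

Lemma trace_class_gelfand : gelfand A s.
Proof. exact: singular_value_gelfand trace_class_cluster_compact. Qed.

Lemma trace_class_summable : exists S : R, forall n, \sum_(k < n) s k <= S.
Proof.
have [_ tr] := hA; exists (fine (trace_norm A)) => n.
have s0 k : (0 <= (s k)%:E)%E by rewrite lee_fin singular_value_ge0.
have tr0 : (0 <= trace_norm A)%E by apply: nneseries_ge0 => k _ _.
have := nneseries_lim_ge n (fun k _ _ => s0 k) : (_ <= trace_norm A)%E.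
rewrite big_mkord sumEFin -{1}[trace_norm A]fineK ?lee_fin //.
by rewrite ge0_fin_numE.
Qed.

(** The partial products increase and stay below exp (r S), so the limit defining [detF] exists and
    dominates them. *)
Lemma prod_le_detF (r : R) n : 0 <= r -> \prod_(k < n) (1 + r * s k) <= detF A r.
Proof.
move=> r0; have [S hS] := trace_class_summable.
pose u n := \prod_(k < n) (1 + r * s k).
have s1 k : 1 <= 1 + r * s k by rewrite lerDl mulr_ge0 ?singular_value_ge0.
have u0 m : 0 <= u m by apply: prodr_ge0 => k _; apply: le_trans (s1 k).
have und : nondecreasing_seq u.
  by apply/nondecreasing_seqP => m; rewrite /u big_ord_recr /= ler_peMr ?u0.
apply: (nondecreasing_cvgn_le und); apply: nondecreasing_is_cvgn => //.
exists (expR (r * S)) => _ [m _ <-].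
apply: (@le_trans _ _ (\prod_(k < m) expR (r * s k))).
  by apply: ler_prod => k _; rewrite expR_ge1Dx (le_trans _ (s1 k)).
by rewrite -expR_sum ler_expR -mulr_sumr ler_wpM2l.
Qed.

End TraceClass.

Definition scale_op (R : realType) (H : hilbertType R) (c : R[i]) (x : H) : H := c *: x.

Lemma scale_op_is_linear (R : realType) (H : hilbertType R) (c : R[i]) :
  linear (@scale_op R H c).
Proof. by move=> a x y; rewrite /scale_op scalerDr !scalerA mulrC. Qed.
HB.instance Definition _ (R : realType) (H : hilbertType R) (c : R[i]) :=
  GRing.isLinear.Build R[i] H H *:%R (@scale_op R H c) (@scale_op_is_linear R H c).

Lemma rnorm_lim_prod_le (R : realType) (u : nat -> R[i]^o) (B : R) : 0 <= B ->
  (forall eps : R, 0 < eps -> exists n0, forall n, (n0 <= n)%N ->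
     expR (- eps) * rnorm (u n) <= B) ->
  rnorm (lim (u @ \oo)) <= B.
Proof.
(* For a divergent sequence [lim] is the default value 0. *)
move=> B0 hB; have [cu|/dvgP ->] := pselect (cvg (u @ \oo)); last by rewrite rnorm0.
set p := lim _; apply/ler_addgt0Pr => eps e0.
have p0 := rnorm_ge0 p.
(* Replacing exp (- d) by 1 costs at most d |p| <= eps / 2, and replacing p by u_n another eps /
   2. *)
pose d := eps / (2 * (rnorm p + 1)).
have p1 : 0 < 2 * (rnorm p + 1) by rewrite mulr_gt0 // ltr_wpDl.
have d0 : 0 < d by rewrite divr_gt0.
have e2 : 0 < eps / 2 by rewrite divr_gt0.
have [n0 hn0] := hB d d0.
move/cvgrPdist_lt : cu => /(_ (eps / 2)%:C); rewrite ltcR => /(_ e2)[n1 _ hn1].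
pose n := maxn n0 n1.
have := hn0 n (leq_maxl _ _).
have := hn1 n (leq_maxr _ _); rewrite /= normE ltcR -/p => h1 h2.
have h3 := rnorm_sub p (u n).
have x0 : 0 < expR (- d) by rewrite expR_gt0.
have x1 : expR (- d) <= 1 by rewrite -expR0 ler_expR oppr_le0 ltW.
have x2 := expR_ge1Dx (- d).
have h4 : d * rnorm p <= eps / 2.
  rewrite /d -mulrA mulrC -mulrA [_ * eps]mulrC mulrA.
  rewrite invfM; set q := rnorm p + 1 in p1 *.
  have q0 : 0 < q by rewrite /q; lra.
  have : q^-1 * rnorm p <= 1 by rewrite mulrC ler_pdivrMr // mul1r lerDl.
  nra.
have h5 : expR (- d) * rnorm p <= expR (- d) * (rnorm (p - u n) + rnorm (u n)).
  by rewrite ler_wpM2l // ltW.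
have h6 : expR (- d) * rnorm (p - u n) <= rnorm (p - u n).
  by rewrite ler_piMl ?rnorm_ge0.
nra.
Qed.

Theorem proposition3p4 (R : realType) (H : hilbertType R)
    (hinf : infinite_dimensional H) (hsep : separable H)
    (A B : {linear H -> H}) (hA : trace_class A) (hB : bounded_operator B)
    (z : R[i]) (hz : (resolvent_set A `&` point_spectrum B) z) :
  rnorm (det_1sub (fun x => z^-1 *: A x)) <=
    opnorm (fun x => A x - B x) / dist_to z (spectrum A)
      * detF A (1 / dist_to z (spectrum A)).
Proof.
have [zr [x x0 Bx]] := hz.
have cA := trace_class_cluster_compact hA.
have gA := trace_class_gelfand hA.
have [S hS] := trace_class_summable hA.
have s0 := singular_value_ge0 A.
have sm (d : R) : 0 < d -> exists k, singular_value A k <= d.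
  by move=> d0; apply: summable_small hS d0.
have spec0 := zero_in_spectrum hinf gA sm.
have z0 : z != 0 by apply: contra_not_neq spec0 => <-.
have nz0 : 0 < rnorm z by rewrite rnorm_gt0.
have [d d0 hd] := resolvent_open zr.
set D := dist_to z (spectrum A).
have E0 : [set rnorm (z - l) | l in spectrum A] !=set0 by exists (rnorm (z - 0)), 0.
have Dlb : lbound [set rnorm (z - l) | l in spectrum A] d.
  by move=> _ [l /= hl <-]; rewrite leNgt; apply/negP => /hd /hl.
have D0 : 0 < D by apply: lt_le_trans d0 (lb_le_inf E0 Dlb).
(* The point 0 of the spectrum competes in the infimum; this allows 1 / |z| to be replaced by 1 /
   D. *)
have Dz : D <= rnorm z.
  rewrite -[z]subr0; apply: ge_inf; first by exists d.
  by exists 0.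
pose T : {linear H -> H} := scale_op z^-1 \o A.
have cT : cluster_compact T.
  apply: (@cluster_compact_comp_l _ _ _ _ (rnorm z^-1)) => // y.
  by rewrite /= /scale_op rnormZ.
(* These numbers are Gelfand bounds for [T] inherited from [A], so the singular values of [T] need
   not be computed. *)
pose s k := rnorm z^-1 * singular_value A k.
have gT : gelfand T s.
  move=> k; have [us hus] := gA k; exists us => y /hus hy.
  by rewrite /= /scale_op rnormZ /s -mulrA ler_wpM2l ?rnorm_ge0.
have sT0 k : 0 <= s k by rewrite mulr_ge0 ?rnorm_ge0.
have sTS n : \sum_(k < n) s k <= rnorm z^-1 * S.
  by rewrite -mulr_sumr ler_wpM2l ?rnorm_ge0.
have zD : rnorm z^-1 <= D^-1 by rewrite rnormV lef_pV2.
set F := detF A (1 / D).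
have FT n : \prod_(k < n) (1 + s k) <= F.
  apply: (@le_trans _ _ (\prod_(k < n) (1 + 1 / D * singular_value A k))).
    apply: ler_prod => k _; rewrite addr_ge0 //= lerD2l mul1r /s.
    by rewrite ler_wpM2r.
  by apply: prod_le_detF => //; rewrite divr_ge0 // ltW.
have F0 : 0 <= F by apply: le_trans (FT 0%N); rewrite big_ord0.
have en : eigenvalue_enumeration T (Defs.eigenvalue T).
  exact: (@xgetPex _ (fun=> 0) _ (eigenvalue_enumeration_exists cT)).
have bA : bounded_operator A.
  by have [M _ hM] := cluster_compact_bounded cA; exists M.
have nx0 : 0 < rnorm x by rewrite rnorm_gt0.
set op := opnorm _.
(* The eigenvector equation B x = z x enters here: x - T x = (B x - A x) / z. *)
have op_x : rnorm (x - T x) <= op / D * rnorm x.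
  have -> : x - T x = z^-1 *: - (A x - B x).
    by rewrite opprB scalerBr Bx scalerA mulVf // scale1r.
  rewrite rnormZ rnormN mulrC [op / D]mulrC -mulrA [_ * rnorm z^-1]mulrC.
  by apply: ler_pM => //; rewrite ?rnorm_ge0 //; apply: le_opnorm.
have op0 : 0 <= op / D.
  by rewrite -(pmulr_lge0 _ nx0) (le_trans _ op_x) // rnorm_ge0.
apply: rnorm_lim_prod_le; first by rewrite mulr_ge0.
move=> eps e0.
have [n0 hn0] := determinant_estimate x cT gT sT0 sTS FT en e0.
exists n0 => n /hn0 h; rewrite -(ler_pM2r nx0) -(mulrA (expR _)).
apply: le_trans h _.
by rewrite [op / D * F * _]mulrAC ler_wpM2r.
Qed.
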